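(* Let $n\ge1$ and let $\lambda\in\mathcal{SP}_n$ be a strict partition of length at most $n$. (1) $P^{\mathbb L}_\lambda(x_1,\ldots,x_n)$ and $Q^{\mathbb L}_\lambda(x_1,\ldots,x_n)$ are in $\Gamma^{\mathbb L}(\mathbf x_n)$. Moreover, $Q^{\mathbb L}_\lambda(x_1,\ldots,x_n)$ is an element of $\Gamma^{\mathbb L}_+(\mathbf x_n)$. (2) $P^{\mathbb L}_\lambda(x_1,\ldots,x_n|\mathbf b)$ is in $\Gamma^{\mathbb L}(\mathbf x_n|\mathbf b)$, whereas $Q^{\mathbb L}_\lambda(x_1,\ldots,x_n|\mathbf b)$ is in $\Gamma^{\mathbb L}_+(\mathbf x_n|\mathbf b)$.
   Context: $\mathbb L$ is the Lazard ring with universal formal group law $F_{\mathbb L}(u,v)=u+v+\sum_{i,j\ge1}a_{i,j}u^iv^j$; $a+_Fb=F_{\mathbb L}(a,b)$ and $\overline a\in\mathbb L[[a]]$ is the formal inverse ($a+_F\overline a=0$). $\mathbf b=(b_1,b_2,\ldots)$ are parameters. For $k\ge1$ put $[t|\mathbf b]^k=\prod_{i=1}^k(t+_Fb_i)$, $[[t|\mathbf b]]^k=(t+_Ft)[t|\mathbf b]^{k-1}$, with $[t|\mathbf b]^0=[[t|\mathbf b]]^0=1$. For $\lambda=(\lambda_1,\ldots,\lambda_r)$ put $[\mathbf x|\mathbf b]^\lambda=\prod_{i=1}^r[x_i|\mathbf b]^{\lambda_i}$ and $[[\mathbf x|\mathbf b]]^\lambda=\prod_{i=1}^r[[x_i|\mathbf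 b]]^{\lambda_i}$. $\mathcal{SP}_n$ is the set of strict partitions $\lambda_1>\cdots>\lambda_r>0$ of length $r\le n$. For such $\lambda$, the universal factorial Schur $P$- and $Q$-functions are $$P^{\mathbb L}_\lambda(\mathbf x_n|\mathbf b)=\frac1{(n-r)!}\sum_{w\in S_n}w\Big[[\mathbf x|\mathbf b]^\lambda\prod_{i=1}^r\prod_{j=i+1}^n\frac{x_i+_Fx_j}{x_i+_F\overline x_j}\Big],$$ $$Q^{\mathbb L}_\lambda(\mathbf x_n|\mathbf b)=\frac1{(n-r)!}\sum_{w\in S_n}w\Big[[[\mathbf x|\mathbf b]]^\lambda\prod_{i=1}^r\prod_{j=i+1}^n\frac{x_i+_Fx_j}{x_i+_F\overline x_j}\Big],$$ where $S_n$ permutes $x_1,\ldots,x_n$; these are formal power series in the $x_i$ and $b_j$ over $\mathbb L$. Put $P^{\mathbb L}_\lambda(\mathbf x_n)=P^{\mathbb L}_\lambda(\mathbf x_n|0)$, $Q^{\mathbb L}_\lambda(\mathbf x_n)=Q^{\mathbb L}_\lambda(\mathbf x_n|0)$. A power series $f(x_1,\ldots,x_n)$ over $\mathbb L$ is $\mathbb L$-supersymmetric if it is symmetric in $x_1,\ldots,x_n$ and $f(t,\overline t,x_3,\ldots,x_n)=f(0,0,x_3,\ldots,x_n)$. $\Gamma^{\mathbb L}(\mathbf x_n)$ is the ring of all such series, and $\Gamma^{\mathbb L}_+(\mathbf x_n)$ is its subring of those $f$ with $f(t,x_2,\ldots,x_n)-f(0,x_2,\ldots,x_n)$ divisible by $t+_Ft$.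 Finally $\Gamma^{\mathbb L}(\mathbf x_n|\mathbf b)=\mathbb L[[\mathbf b]]\,\hat\otimes_{\mathbb L}\,\Gamma^{\mathbb L}(\mathbf x_n)$ and $\Gamma^{\mathbb L}_+(\mathbf x_n|\mathbf b)=\mathbb L[[\mathbf b]]\,\hat\otimes_{\mathbb L}\,\Gamma^{\mathbb L}_+(\mathbf x_n)$, i.e. formal power series in $b_1,b_2,\ldots$ with coefficients in $\Gamma^{\mathbb L}(\mathbf x_n)$, resp. $\Gamma^{\mathbb L}_+(\mathbf x_n)$. *)

(* Defs.v *)
From HB Require Import structures.
From mathcomp Require Import all_boot all_order all_fingroup all_algebra.
From mathcomp Require Import finmap.
From mathcomp Require Import monalg.
From mathcomp Require Import boolp.

Set Implicit Arguments.
Unset Strict Implicit.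
Unset Printing Implicit Defensive.

Import GRing.Theory.
Local Open Scope ring_scope.
Local Notation "k ** l" := (mmul k l) (at level 40, left associativity).

(* Formal power series over R in the variables indexed by I, as arbitrary
   families of coefficients.  For infinite I this is the full power series
   ring: infinitely many monomials of the same degree may occur.  Equality of
   power series is decided classically. *)

Record fps (I : choiceType) (R : Type) := Fps { fcoef : {cmonom I} -> R }.

HB.instance Definition _ (I : choiceType) (R : Type) := gen_eqMixin (fps I R).
HB.instance Definition _ (I : choiceType) (R : Type) :=
  gen_choiceMixin (fps I R).

Lemma fpsP (I : choiceType) (R : Type) (f g : fps I R) :
  (forall m, fcoef f m = fcoef g m) -> f = g.
Proof. by case: f g => f [g] /= h; congr Fps; apply: funext. Qed.

Section Divisors.
Variable I : choiceType.
Implicit Types m k l : {cmonom I}.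

Definition divisors_cm m : seq {cmonom I} :=
  undup [seq k <- [seq [cmonom (h i : nat) | i : finsupp m]%M
                  | h : {ffun finsupp m -> 'I_(mdeg m).+1}]
        | k ** divcm m k == m].

Lemma leq_mdeg m i : (m i <= mdeg m)%N.
Proof.
rewrite mdegE; case: mdomP => // im.
by rewrite (big_fsetD1 i) //= leq_addr.
Qed.

Lemma mulcmK k l : divcm (k ** l) k = l.
Proof. by apply/eqP/cmP => i; rewrite divcmE cmM addKn. Qed.

Lemma mem_divisors_cm m k : (k \in divisors_cm m) = (k ** divcm m k == m).
Proof.
rewrite mem_undup mem_filter; case: eqP => //= km.
apply/imageP.
have lek i : (k i < (mdeg m).+1)%N.
  by rewrite ltnS (leq_trans _ (leq_mdeg m i)) // -km cmM leq_addr.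
exists [ffun i => Ordinal (lek (val i))] => //.
apply/eqP/cmP => i; rewrite cmE fsfun_ffun.
case: insubP => [u ui <-|im]; first by rewrite /= ffunE.
rewrite /=; have := im; rewrite -cmE_eq0 -[in m i]km cmM addn_eq0.
by move=> /andP[/eqP].
Qed.

Lemma mem_divisors_cmP m k : reflect (exists l, m = k ** l) (k \in divisors_cm m).
Proof.
rewrite mem_divisors_cm; apply: (iffP eqP) => [<-|[l ->]]; last by rewrite mulcmK.
by exists (divcm m k).
Qed.

Lemma divisors_cm_uniq m : uniq (divisors_cm m).
Proof. exact: undup_uniq. Qed.

End Divisors.

Section Ring.
Variables (I : choiceType) (R : comNzRingType).
Implicit Types f g h : fps I R.

Definition fps_const (c : R) : fps I R :=
  Fps (fun m => if m == mone then c else 0).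
Definition fps_add f g : fps I R := Fps (fun m => fcoef f m + fcoef g m).
Definition fps_opp f : fps I R := Fps (fun m => - fcoef f m).
Definition fps_mul f g : fps I R :=
  Fps (fun m => \sum_(k <- divisors_cm m) fcoef f k * fcoef g (divcm m k)).

Lemma fps_addA : associative fps_add.
Proof. by move=> f g h; apply: fpsP => m /=; rewrite addrA. Qed.
Lemma fps_addC : commutative fps_add.
Proof. by move=> f g; apply: fpsP => m /=; rewrite addrC. Qed.
Lemma fps_add0 : left_id (fps_const 0) fps_add.
Proof. by move=> f; apply: fpsP => m /=; rewrite if_same add0r. Qed.
Lemma fps_addN : left_inverse (fps_const 0) fps_opp fps_add.
Proof. by move=> f; apply: fpsP => m /=; rewrite if_same addNr. Qed.

HB.instance Definition _ := GRing.isZmodule.Build (fps I R)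
  fps_addA fps_addC fps_add0 fps_addN.

Lemma fps_mulC : commutative fps_mul.
Proof.
move=> f g; apply: fpsP => m /=.
have invm k : k \in divisors_cm m -> divcm m (divcm m k) = k.
  by move=> /mem_divisors_cmP[l ->]; rewrite mulcmK mulmC mulcmK.
have memm k : k \in divisors_cm m -> divcm m k \in divisors_cm m.
  by move=> kd; rewrite mem_divisors_cm invm // mulmC; rewrite mem_divisors_cm in kd.
transitivity (\sum_(k <- [seq divcm m l | l <- divisors_cm m])
                fcoef g k * fcoef f (divcm m k)).
  rewrite big_map big_seq [RHS]big_seq; apply: eq_bigr => k kd.
  by rewrite invm // mulrC.
apply/perm_big/uniq_perm; rewrite ?divisors_cm_uniq //.
  rewrite map_inj_in_uniq ?divisors_cm_uniq // => k l kd ld e.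
  by rewrite -(invm k kd) e invm.
move=> k; apply/mapP/idP => [[l ld ->]|kd]; first exact: memm.
by exists (divcm m k); rewrite ?memm ?invm.
Qed.

Lemma fps_mulA : associative fps_mul.
Proof.
move=> f g h; apply: fpsP => m /=.
pose T : {cmonom I} * {cmonom I} -> R := fun p =>
  fcoef f p.1 * fcoef g p.2 * fcoef h (divcm m (p.1 ** p.2)).
transitivity (\sum_(p <- [seq (k, l) | k <- divisors_cm m,
                                       l <- divisors_cm (divcm m k)]) T p).
  rewrite big_allpairs_dep big_seq [RHS]big_seq; apply: eq_bigr => k.
  move=> /mem_divisors_cmP[k' em].
  rewrite [in LHS]em [in RHS]em mulcmK mulr_sumr.
  rewrite big_seq [RHS]big_seq; apply: eq_bigr => l /mem_divisors_cmP[l' el].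
  by rewrite /T /= em el mulcmK mulmA mulcmK mulrA.
transitivity (\sum_(p <- [seq (k, divcm c k) | c <- divisors_cm m,
                                       k <- divisors_cm c]) T p); last first.
  rewrite big_allpairs_dep big_seq [RHS]big_seq; apply: eq_bigr => c _.
  rewrite mulr_suml big_seq [RHS]big_seq; apply: eq_bigr => k.
  by move=> /mem_divisors_cmP[k' ->]; rewrite /T /= mulcmK.
apply/perm_big/uniq_perm.
- apply: allpairs_uniq_dep; rewrite ?divisors_cm_uniq //.
    by move=> k _; apply: divisors_cm_uniq.
  by move=> [k l] [k' l'] _ _ /= [-> ->].
- apply: allpairs_uniq_dep; rewrite ?divisors_cm_uniq //.
    by move=> k _; apply: divisors_cm_uniq.
  move=> [c k] [c' k'] /allpairsPdep[d [e [_ de [-> ->]]]].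
  move=> /allpairsPdep[d' [e' [_ de' [-> ->]]]] /= [ee].
  move/mem_divisors_cmP: de => [u ->]; move/mem_divisors_cmP: de' => [u' ->].
  by rewrite ee !mulcmK => ->.
move=> [a b]; apply/allpairsPdep/allpairsPdep.
  move=> [k [l [/mem_divisors_cmP[k' ->]]]]; rewrite mulcmK.
  move=> /mem_divisors_cmP[l' ->] [-> ->].
  exists (k ** l), k; rewrite mulcmK; split=> //; apply/mem_divisors_cmP.
    by exists l'; rewrite mulmA.
  by exists l.
move=> [c [k [/mem_divisors_cmP[c' ->]]]].
move=> /mem_divisors_cmP[k' ->] [-> ->].
exists k, k'; rewrite mulcmK; split=> //; apply/mem_divisors_cmP.
  by exists (k' ** c'); rewrite mulmA.
by rewrite -mulmA mulcmK; exists c'.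
Qed.

Lemma fps_mul1 : left_id (fps_const 1) fps_mul.
Proof.
move=> f; apply: fpsP => m /=.
have d1 : mone \in divisors_cm m by apply/mem_divisors_cmP; exists m; rewrite mul1m.
rewrite (bigD1_seq mone) ?divisors_cm_uniq //= eqxx mul1r big1 => [|k /negPf->].
  by rewrite addr0 -{1}[m]mul1m mulcmK.
by rewrite mul0r.
Qed.

Lemma fps_mulDl : left_distributive fps_mul fps_add.
Proof.
move=> f g h; apply: fpsP => m /=; rewrite -big_split /=.
by apply: eq_bigr => k _; rewrite mulrDl.
Qed.

Lemma fps_1neq0 : fps_const 1 != 0.
Proof.
apply/eqP => /(congr1 (fun f => fcoef f mone)) /= /eqP.
by rewrite eqxx oner_eq0.
Qed.

HB.instance Definition _ := GRing.Zmodule_isComNzRing.Build (fps I R)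
  fps_mulA fps_mulC fps_mul1 fps_mulDl fps_1neq0.

End Ring.

Definition fps_var (I : choiceType) (R : comNzRingType) (i : I) : fps I R :=
  Fps (fun m => if m == ucm i then 1 else 0).

Notation "''x_' i" := (@fps_var _ _ i)
  (at level 8, i at level 2, format "''x_' i") : ring_scope.

Definition fps_map (I : choiceType) (R S : Type) (phi : R -> S) (f : fps I R) :
  fps I S := Fps (fun m => phi (fcoef f m)).

(* The monomial with exponent vector a. *)
Definition monom_of (n d : nat) (a : {ffun 'I_n -> 'I_d}) : {cmonom 'I_n} :=
  [cmonom (a i : nat) | i in [fset i : 'I_n | true]%fset]%M.

(* The substitution f(g_0, ..., g_(n-1)), for g_i without constant term: the
   coefficient of m in g^a vanishes as soon as one exponent a_i exceeds the
   degree of m, so the infinite sum over a may be truncated there. *)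
Definition fps_subst (n : nat) (I : choiceType) (R : comNzRingType)
    (f : fps 'I_n R) (g : 'I_n -> fps I R) : fps I R :=
  Fps (fun m => \sum_(a : {ffun 'I_n -> 'I_(mdeg m).+1})
                  fcoef f (monom_of a) * fcoef (\prod_(i < n) g i ^+ a i) m).

Section FormalGroupLaw.
Variable R : comNzRingType.
Implicit Types (F : fps 'I_2 R) (chi : fps 'I_1 R).

(* f +_F g and the formal inverse of f, for f, g without constant term; the
   series chi is the formal inverse of a variable. *)
Definition fgl_add F (I : choiceType) (f g : fps I R) : fps I R :=
  fps_subst F (fun i : 'I_2 => if val i == 0%N then f else g).

Definition fgl_opp chi (I : choiceType) (f : fps I R) : fps I R :=
  fps_subst chi (fun _ : 'I_1 => f).

(* One-dimensional commutative formal group laws; the axioms are stated in the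
   variables 'x_0, 'x_1, 'x_2 of R[['x_0, 'x_1, ...]]. *)
Definition is_fgl F : Prop :=
  let u : fps nat R := 'x_0%N in
  let v : fps nat R := 'x_1%N in
  let w : fps nat R := 'x_2%N in
  [/\ fgl_add F u 0 = u, fgl_add F 0 u = u,
      fgl_add F u v = fgl_add F v u &
      fgl_add F (fgl_add F u v) w = fgl_add F u (fgl_add F v w)].

Definition is_fgl_inverse F chi : Prop :=
  fcoef chi mone = 0 /\ fgl_add F ('x_ord0 : fps 'I_1 R) chi = 0.

End FormalGroupLaw.

(* (L, F) is the Lazard ring with its universal formal group law. *)
Definition is_lazard (L : comNzRingType) (F : fps 'I_2 L) : Prop :=
  is_fgl F /\
  forall (R : comNzRingType) (G : fps 'I_2 R), is_fgl G ->
    exists phi : {rmorphism L -> R}, fps_map phi F = G /\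
      forall psi : {rmorphism L -> R}, fps_map psi F = G -> psi =1 phi.

Definition strict_partition (lam : seq nat) : bool :=
  sorted gtn lam && all (fun k => 0 < k)%N lam.

(* f = 1/m * \sum_i N i / D i, with denominators cleared. *)
Definition is_sum_of_fractions (A : comNzRingType) (T : finType) (m : nat)
    (N D : T -> A) (f : A) : Prop :=
  m%:R * (\prod_t D t) * f = \sum_t N t * \prod_(s | s != t) D s.

Section SchurPQ.
Variables (L : comNzRingType) (F : fps 'I_2 L) (chi : fps 'I_1 L).
Variable (I : choiceType).
Local Notation A := (fps I L).
Local Notation "f +_F g" := (fgl_add F f g) (at level 50, left associativity).

(* The parameters are indexed from 0: b 0, b 1, ... are b_1, b_2, ... *)
Definition bpow (b : nat -> A) (t : A) (k : nat) : A :=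
  \prod_(i < k) (t +_F b i).

Definition bbpow (b : nat -> A) (t : A) (k : nat) : A :=
  if k is k'.+1 then (t +_F t) * bpow b t k' else 1.

Variables (n : nat) (lam : seq nat).
Local Notation r := (size lam).

(* Numerator and denominator of the summand, as functions of (x_1, ..., x_n);
   the permutation w acts by replacing each x_i with x_(w i).  Variables and
   parts are indexed from 0. *)
Definition P_num (b : nat -> A) (x : 'I_n -> A) : A :=
  (\prod_(i < n | (i < r)%N) bpow b (x i) (nth 0%N lam i)) *
  \prod_(i < n | (i < r)%N) \prod_(j < n | (i < j)%N) (x i +_F x j).

Definition Q_num (b : nat -> A) (x : 'I_n -> A) : A :=
  (\prod_(i < n | (i < r)%N) bbpow b (x i) (nth 0%N lam i)) *
  \prod_(i < n | (i < r)%N) \prod_(j < n | (i < j)%N) (x i +_F x j).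

Definition PQ_den (x : 'I_n -> A) : A :=
  \prod_(i < n | (i < r)%N) \prod_(j < n | (i < j)%N)
    (x i +_F fgl_opp chi (x j)).

(* Over the Lazard ring, which is torsion free, the cleared denominator is not
   a zero divisor when the x_i are distinct variables, so that these relations
   determine the power series f. *)
Definition is_schurP (x : 'I_n -> A) (b : nat -> A) (f : A) : Prop :=
  is_sum_of_fractions (n - r)`!
    (fun w : 'S_n => P_num b (fun i => x (w i)))
    (fun w : 'S_n => PQ_den (fun i => x (w i))) f.

Definition is_schurQ (x : 'I_n -> A) (b : nat -> A) (f : A) : Prop :=
  is_sum_of_fractions (n - r)`!
    (fun w : 'S_n => Q_num b (fun i => x (w i)))
    (fun w : 'S_n => PQ_den (fun i => x (w i))) f.

End SchurPQ.

Section Gamma.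
Variables (L : comNzRingType) (F : fps 'I_2 L) (chi : fps 'I_1 L).
Variable n : nat.

Definition symmetric_fps (f : fps 'I_n L) : Prop :=
  forall w : 'S_n, fps_subst f (fun i => 'x_(w i)) = f.

(* In both definitions below the variable t is 'x_None, and x_i is
   'x_(Some i).  For n = 1 the cancellation condition is void. *)
Definition supersymmetric (f : fps 'I_n L) : Prop :=
  symmetric_fps f /\
  let t : fps (option 'I_n) L := 'x_None in
  let at_ (a b : fps (option 'I_n) L) :=
    fps_subst f (fun i => if val i == 0%N then a
                          else if val i == 1%N then b else 'x_(Some i)) in
  ((1 < n)%N -> at_ t (fgl_opp chi t) = at_ 0 0).

Definition Gamma (f : fps 'I_n L) : Prop := supersymmetric f.

Definition Gamma_plus (f : fps 'I_n L) : Prop :=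
  Gamma f /\
  let t : fps (option 'I_n) L := 'x_None in
  let at_ (a : fps (option 'I_n) L) :=
    fps_subst f (fun i => if val i == 0%N then a else 'x_(Some i)) in
  exists g, at_ t - at_ 0 = fgl_add F t t * g.

(* The coefficient of the b-monomial e in a series in the x_i ('x_(inl i)) and
   the b_j ('x_(inr j)). *)
Definition monom_join (a : {cmonom 'I_n}) (e : {cmonom nat}) :
    {cmonom ('I_n + nat)%type} :=
  [cmonom match s with inl i => a i | inr j => e j end
  | s in [fset inl i | i in finsupp a] `|` [fset inr j | j in finsupp e]]%M.

Definition bcoef (f : fps ('I_n + nat)%type L) (e : {cmonom nat}) : fps 'I_n L :=
  Fps (fun a => fcoef f (monom_join a e)).

Definition Gamma_b (f : fps ('I_n + nat)%type L) : Prop :=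
  forall e, Gamma (bcoef f e).

Definition Gamma_plus_b (f : fps ('I_n + nat)%type L) : Prop :=
  forall e, Gamma_plus (bcoef f e).

End Gamma.

(* Main.v *)
(* For weights g_1, ..., g_r in place of the factorial powers, the sum over S_n
   is computed one part at a time: the sum p in x_1, ..., x_n for g_1, ..., g_r
   is \sum_i g_1(x_i) \prod_(j != i) (x_i +_F x_j) / (x_i +_F \bar x_j) p'_i,
   where p'_i is the sum for g_2, ..., g_r in the variables other than x_i.  As
   x_i +_F \bar x_j is a unit times x_i - x_j, this is a Lagrange sum
   \sum_i M_i / \prod_(j != i) (x_i - x_j), which is a power series as soon as
   M_i = M_j when x_i = x_j, over any coefficient ring.

   Cancellation: the poles of the terms k and l along x_k = x_l cancel, and
   their sum keeps the factor x_k +_F x_l, so it vanishes at x_l = \bar x_k; in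
   the other terms the factors of x_k and x_l cancel and p'_i is handled by
   induction.  Divisibility by t +_F t: in p - p(x_l = 0) each term has an
   explicit quotient by x_l +_F x_l, and for a suitable choice the quotients
   form again a Lagrange sum.  Since t +_F t is not cancelled anywhere, no
   property of the Lazard ring beyond the formal group law is used.

   The parameters b are put in the coefficients: the argument runs in
   S[[x_1, ..., x_n]] with S = L[[b_1, b_2, ...]]. *)
Require Import Defs.
From HB Require Import structures.
From mathcomp Require Import all_boot all_order all_fingroup all_algebra.
From mathcomp Require Import finmap.
From mathcomp Require Import monalg.
From mathcomp Require Import boolp.
From mathcomp Require Import ring.

Set Implicit Arguments.
Unset Strict Implicit.
Unset Printing Implicit Defensive.

Import GRing.Theory.
Local Open Scope ring_scope.
Local Notation "k ** l" := (mmul k l) (at level 40, left associativity).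

(** * Power series and substitution *)

(** Over a general ring t +_F t may be a zero divisor, or even 0, as for the additive law in
    characteristic 2. This shapes both inductive steps. Cancellation: under x_l = \bar x_k the
    denominator x_k - x_l becomes a unit times x_k +_F x_k, so it must not survive until then. The
    terms k and l are merged, and x_k - x_l is cancelled, while x_k and x_l are still independent.
    The factors x_k - x_j and \bar x_k - x_j that remain are regular, since x_i - y is regular over
    any ring when y does not involve x_i. Divisibility: a quotient by t +_F t is not unique, so it
    does not inherit the symmetry of p. The induction therefore carries a family of quotients G_i
    with w G_i = G_(w i); this equivariance, together with Q(x,x) = C(x,x), gives the Lagrange
    condition for the next family. Return to L: taking the coefficient of a monomial in b is only
    L-linear, but t +_F t and all substituted series have coefficients in L, so both conditions pass
    to the coefficients. *)

Lemma mdeg_ordE n (a : {cmonom 'I_n}) : mdeg a = (\sum_(i < n) a i)%N.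
Proof.
rewrite (@mdegEw _ a [fset i : 'I_n | true]%fset).
  by rewrite big_uniq ?fset_uniq //=; apply: eq_bigl => i; rewrite !inE.
by apply/fsubsetP => i _; rewrite !inE.
Qed.

Lemma monom_ofE n d (a : {ffun 'I_n -> 'I_d}) i : monom_of a i = a i :> nat.
Proof. by rewrite cmE fsfun_fun !inE. Qed.

Lemma monom_of_inj n d : injective (@monom_of n d).
Proof.
move=> a b e; apply/ffunP => i; apply: val_inj => /=.
by rewrite -!monom_ofE e.
Qed.

(** Only the nonzero terms count; this frees [fps_subst] from its truncation bound, which depends on
    the monomial. *)
Lemma big_uniq_supp (R : nmodType) (T : eqType) (s t : seq T) (H : T -> R) :
  uniq s -> uniq t -> (forall a, H a != 0 -> a \in s) ->
  (forall a, H a != 0 -> a \in t) -> \sum_(a <- s) H a = \sum_(a <- t) H a.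
Proof.
move=> us ut hs ht.
have E r : \sum_(a <- r) H a = \sum_(a <- [seq a <- r | H a != 0]) H a.
  rewrite big_filter [LHS](bigID (fun a => H a != 0)) /=.
  by rewrite [X in _ + X]big1 ?addr0 // => a /negPn/eqP.
rewrite E [RHS]E; apply/perm_big/uniq_perm; rewrite ?filter_uniq // => a.
rewrite !mem_filter; case: eqP => //= h.
by rewrite hs ?ht //; apply/eqP.
Qed.

Section Series.
Variables (I : choiceType) (R : comNzRingType).
Implicit Types (f g h : fps I R) (m k a b : {cmonom I}).

Lemma fcoef0 m : fcoef (0 : fps I R) m = 0.
Proof. exact: if_same. Qed.

Lemma fcoef1 m : fcoef (1 : fps I R) m = (m == mone)%:R.
Proof. by rewrite /=; case: eqP. Qed.

Lemma fcoefD f g m : fcoef (f + g) m = fcoef f m + fcoef g m.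
Proof. by []. Qed.

Lemma fcoefN f m : fcoef (- f) m = - fcoef f m.
Proof. by []. Qed.

Lemma fcoefB f g m : fcoef (f - g) m = fcoef f m - fcoef g m.
Proof. by []. Qed.

Lemma fcoef_sum T (s : seq T) (P : pred T) (F : T -> fps I R) m :
  fcoef (\sum_(i <- s | P i) F i) m = \sum_(i <- s | P i) fcoef (F i) m.
Proof.
exact: (big_morph (fun f : fps I R => fcoef f m) (fun f g =>
  fcoefD f g m) (fcoef0 m)).
Qed.

Lemma fcoefM f g m :
  fcoef (f * g) m = \sum_(k <- divisors_cm m) fcoef f k * fcoef g (divcm m k).
Proof. by []. Qed.

(* Locked, since unification would otherwise compare coefficient functions. *)
Fact fps_key : unit. Proof. by []. Qed.
Definition fmon : {cmonom I} -> fps I R :=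
  locked_with fps_key (fun a => Fps (fun m => (m == a)%:R)).
Definition fX : I -> fps I R := locked_with fps_key (fun i => 'x_i).

Lemma fXE i : 'x_i = fX i.
Proof. by rewrite /fX unlock. Qed.

Lemma fcoef_mon a m : fcoef (fmon a) m = (m == a)%:R.
Proof. by rewrite /fmon unlock. Qed.

Lemma fvarE i : fX i = fmon (ucm i).
Proof. by apply: fpsP => m; rewrite fcoef_mon -fXE /=; case: eqP. Qed.

Lemma fmon1 : fmon mone = 1.
Proof. by apply: fpsP => m; rewrite fcoef1 fcoef_mon. Qed.

Lemma fcoef_monM a f m :
  fcoef (fmon a * f) m = if a \in divisors_cm m then fcoef f (divcm m a) else 0.
Proof.
rewrite fcoefM; case: ifP => ha.
  rewrite (bigD1_seq a) ?divisors_cm_uniq //= fcoef_mon eqxx mul1r big1 ?addr0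
    //.
  by move=> k /negPf h; rewrite fcoef_mon h mul0r.
rewrite big_seq big1 // => k kd; rewrite fcoef_mon; case: eqP kd => [->|_ _].
  by rewrite ha.
by rewrite mul0r.
Qed.

Lemma fcoef_monMl a f m : fcoef (fmon a * f) (a ** m) = fcoef f m.
Proof.
by rewrite fcoef_monM mulcmK; case: mem_divisors_cmP => // -[]; exists m.
Qed.

Lemma fmonM a b : fmon (a ** b) = fmon a * fmon b.
Proof.
apply: fpsP => m; rewrite fcoef_monM !fcoef_mon.
case: mem_divisors_cmP => [[l ->]|h].
  rewrite mulcmK; congr (nat_of_bool _)%:R; apply/eqP/eqP => [|-> //].
  by move=> e; rewrite -(mulcmK a l) e mulcmK.
by case: eqP => // e; case: h; exists b.
Qed.

Lemma fcoefC (c : R) m : fcoef (fps_const I c) m = c *+ (m == mone).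
Proof. by rewrite /=; case: eqP. Qed.

Lemma fcoef_constM (c : R) f m : fcoef (fps_const I c * f) m = c * fcoef f m.
Proof.
have d1 : mone \in divisors_cm m by apply/mem_divisors_cmP; exists m;
  rewrite mul1m.
rewrite fcoefM (bigD1_seq mone) ?divisors_cm_uniq //= eqxx big1 =>
  [|k /negPf->].
  by rewrite addr0 -{1}[m]mul1m mulcmK.
by rewrite mul0r.
Qed.

Lemma fps_const_is_nmod_morphism : nmod_morphism (@fps_const I R).
Proof.
split; first by apply: fpsP.
by move=> a b; apply: fpsP => m /=; case: eqP; rewrite ?addr0.
Qed.

Lemma fps_const_is_monoid_morphism : monoid_morphism (@fps_const I R).
Proof.
split; first exact: erefl.
by move=> a b; apply: fpsP => m; rewrite fcoef_constM /=; case: eqP;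
  rewrite ?mulr0.
Qed.

HB.instance Definition _ := GRing.isNmodMorphism.Build R (fps I R)
  (@fps_const I R) fps_const_is_nmod_morphism.
HB.instance Definition _ := GRing.isMonoidMorphism.Build R (fps I R)
  (@fps_const I R) fps_const_is_monoid_morphism.

(** The filtration by total degree. It is separated ([fordP]), so identities between infinite
    substitutions can be checked on truncations. *)
Definition ford N f := forall m, (mdeg m < N)%N -> fcoef f m = 0.

Lemma fordP f g : (forall N, ford N (f - g)) -> f = g.
Proof.
move=> h; apply: fpsP => m; apply/eqP; rewrite -subr_eq0 -fcoefB; apply/eqP.
exact: (h (mdeg m).+1).
Qed.

Lemma fordD N f g : ford N f -> ford N g -> ford N (f + g).
Proof. by move=> hf hg m hm; rewrite fcoefD hf ?hg ?addr0. Qed.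

Lemma fordN N f : ford N f -> ford N (- f).
Proof. by move=> hf m hm; rewrite fcoefN hf ?oppr0. Qed.

Lemma fordB N f g : ford N f -> ford N g -> ford N (f - g).
Proof. by move=> hf hg; apply/fordD/fordN. Qed.

Lemma fordM (a b : nat) f g : ford a f -> ford b g -> ford (a + b) (f * g).
Proof.
move=> hf hg m hm; rewrite fcoefM big_seq big1 // => k /mem_divisors_cmP[l em].
rewrite em mulcmK; move: hm; rewrite em mdegM => hm.
have [ka|ka] := ltnP (mdeg k) a; first by rewrite hf ?mul0r.
rewrite hg ?mulr0 // -(ltn_add2l a); apply: leq_ltn_trans hm.
by rewrite leq_add2r.
Qed.

Lemma fordMl N f g : ford N f -> ford N (f * g).
Proof. by rewrite -[N in X in _ -> X]addn0 => /fordM; apply => m. Qed.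

Lemma fordMr N f g : ford N f -> ford N (g * f).
Proof. by rewrite mulrC; apply: fordMl. Qed.

Lemma fordX (k : nat) f : ford 1 f -> ford k (f ^+ k).
Proof.
move=> hf; elim: k => [|k IH]; first by move=> m.
by rewrite exprS -add1n; apply: fordM.
Qed.

Lemma ford1 f : fcoef f mone = 0 -> ford 1 f.
Proof. by move=> h m; rewrite ltnS leqn0 mdeg_eq0 => /eqP->. Qed.

Lemma ford1P f : ford 1 f <-> fcoef f mone = 0.
Proof. by split; [apply; rewrite mdeg1 | apply: ford1]. Qed.

Lemma ford_var i : ford 1 (fX i).
Proof. by apply: ford1; rewrite fvarE fcoef_mon eq_sym cm1_eq1. Qed.

Definition fcst f := fcoef f mone.
Arguments fcst : simpl never.

Lemma divisors_mone : divisors_cm (mone : {cmonom I}) = [:: mone].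
Proof.
apply/perm_small_eq => //; apply: uniq_perm; rewrite ?divisors_cm_uniq //.
move=> k; rewrite inE; apply/mem_divisors_cmP/eqP => [[l /esym/eqP]|->].
  by rewrite cmM_eq1 => /andP[/eqP].
by exists mone; rewrite mul1m.
Qed.

Lemma fcst_is_nmod_morphism : nmod_morphism fcst.
Proof. by split=> [|f g] //; rewrite /fcst fcoef0. Qed.

Lemma fcst_is_monoid_morphism : monoid_morphism fcst.
Proof.
split=> [|f g]; first by rewrite /fcst fcoef1 eqxx.
by rewrite /fcst fcoefM divisors_mone big_seq1 -{2}(mul1m mone) mulcmK.
Qed.

HB.instance Definition _ := GRing.isNmodMorphism.Build (fps I R) R
  fcst fcst_is_nmod_morphism.
HB.instance Definition _ := GRing.isMonoidMorphism.Build (fps I R) R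
  fcst fcst_is_monoid_morphism.

Lemma fcst_const (c : R) : fcst (fps_const I c) = c.
Proof. by rewrite /fcst /= eqxx. Qed.

Lemma fcst_var i : fcst (fX i) = 0.
Proof. by apply/ford1P/ford_var. Qed.

Definition trunc0 f := f - fps_const I (fcst f).

Lemma ford_trunc0 f : ford 1 (trunc0 f).
Proof. by apply/ford1P; rewrite -[LHS]/(fcst _) rmorphB /= fcst_const subrr.
  Qed.

Lemma trunc0_id f : fcst f = 0 -> trunc0 f = f.
Proof. by rewrite /trunc0 => ->; rewrite rmorph0 subr0. Qed.

End Series.

Arguments fmon {I R} a.
Arguments fX {I} R i.
Arguments fcst : simpl never.
Arguments fps_const : simpl never.

Section Subst.
Variables (n : nat) (I : choiceType) (R : comNzRingType).
Implicit Types (f h : fps 'I_n R) (g : 'I_n -> fps I R) (a b : {cmonom 'I_n}).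

Definition gpow g a : fps I R := \prod_(i < n) g i ^+ a i.

Lemma gpowM g a b : gpow g (a ** b) = gpow g a * gpow g b.
Proof. by rewrite -big_split; apply: eq_bigr => i _; rewrite cmM exprD. Qed.

Lemma ford_gpow g a : (forall i, ford 1 (g i)) -> ford (mdeg a) (gpow g a).
Proof.
move=> hg; rewrite mdeg_ordE /gpow.
apply: (big_ind2 (fun N x => ford N x)) => [m //|? ? ? ?|i _];
  first exact: fordM.
exact: fordX.
Qed.

(** Since g^a has order at least |a|, every contributing exponent already lies in the built-in
    range; the list [s] can then be chosen for each use, down to a singleton. *)
Lemma fps_substE f g (m : {cmonom I}) (s : seq {cmonom 'I_n}) :
  (forall i, ford 1 (g i)) -> uniq s ->
  (forall a, fcoef f a * fcoef (gpow g a) m != 0 -> a \in s) ->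
  fcoef (fps_subst f g) m = \sum_(a <- s) fcoef f a * fcoef (gpow g a) m.
Proof.
move=> hg us hs.
transitivity (\sum_(a <- [seq monom_of c | c : {ffun 'I_n -> 'I_(mdeg m).+1}])
    fcoef f a * fcoef (gpow g a) m).
  rewrite /= big_map big_enum /=; apply: eq_bigr => c _; congr (_ * fcoef _ _).
  by apply: eq_bigr => i _; rewrite monom_ofE.
apply: big_uniq_supp => //.
  by rewrite map_inj_uniq ?enum_uniq //; apply: monom_of_inj.
move=> a na; have le i : (a i < (mdeg m).+1)%N.
  rewrite ltnS leqNgt; apply/negP => lt; case/eqP: na.
  by rewrite (ford_gpow hg) ?mulr0 // (leq_trans lt) // leq_mdeg.
apply/mapP; exists [ffun i => Ordinal (le i)]; first by rewrite mem_enum.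
by apply/eqP/cmP => i; rewrite monom_ofE ffunE.
Qed.

(** A box of exponents: it contains every monomial of degree below N, and the extra ones of higher
    degree do no harm. *)
Definition monoms N : seq {cmonom 'I_n} :=
  [seq monom_of c | c : {ffun 'I_n -> 'I_N}].

Lemma monoms_uniq N : uniq (monoms N).
Proof. by rewrite map_inj_uniq ?enum_uniq //; apply: monom_of_inj. Qed.

Lemma mem_monoms N a : (mdeg a < N)%N -> a \in monoms N.
Proof.
move=> aN; have le i : (a i < N)%N by apply: leq_ltn_trans aN; apply: leq_mdeg.
apply/mapP; exists [ffun i => Ordinal (le i)]; first by rewrite mem_enum.
by apply/eqP/cmP => i; rewrite monom_ofE ffunE.
Qed.

Definition ftrunc N f : fps 'I_n R :=
  \sum_(a <- monoms N) fps_const _ (fcoef f a) * fmon a.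

Lemma ford_ftrunc N f : ford N (f - ftrunc N f).
Proof.
move=> m mN; rewrite fcoefB fcoef_sum (bigD1_seq m) ?monoms_uniq ?mem_monoms //.
rewrite fcoef_constM fcoef_mon eqxx mulr1 big1 => [|a /negPf h].
  by rewrite [X in _ - X]addr0 subrr.
by rewrite fcoef_constM fcoef_mon eq_sym h mulr0.
Qed.

Section Hom.
Variable g : 'I_n -> fps I R.
Hypothesis hg : forall i, ford 1 (g i).

Lemma fps_substD f h : fps_subst (f + h) g = fps_subst f g + fps_subst h g.
Proof.
apply: fpsP => m; rewrite fcoefD /= -big_split.
by apply: eq_bigr => a _; rewrite mulrDl.
Qed.

Lemma fps_subst0 : fps_subst (0 : fps 'I_n R) g = 0.
Proof.
apply: fpsP => m; rewrite fcoef0 /= big1 // => a _.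
by rewrite if_same mul0r.
Qed.

Lemma fps_subst_constM (c : R) f :
  fps_subst (fps_const _ c * f) g = fps_const _ c * fps_subst f g.
Proof.
apply: fpsP => m; rewrite fcoef_constM.
have E h : fcoef (fps_subst h g) m =
  \sum_(a : {ffun 'I_n -> 'I_(mdeg m).+1})
     fcoef h (monom_of a) * fcoef (\prod_(i < n) g i ^+ a i) m by [].
rewrite !E mulr_sumr; apply: eq_bigr => a _.
by rewrite fcoef_constM mulrA.
Qed.

Lemma fps_subst_mon a : fps_subst (fmon a) g = gpow g a.
Proof.
apply: fpsP => m; rewrite (fps_substE (s := [:: a])) //.
  by rewrite big_seq1 fcoef_mon eqxx mul1r.
by move=> b; rewrite inE fcoef_mon; case: (b =P a) => // _; rewrite mul0r eqxx.
Qed.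

Lemma fps_subst_sum T (s : seq T) (F : T -> fps 'I_n R) :
  fps_subst (\sum_(i <- s) F i) g = \sum_(i <- s) fps_subst (F i) g.
Proof. exact: (big_morph (fun f => fps_subst f g) fps_substD fps_subst0). Qed.

Lemma ford_subst N f : ford N f -> ford N (fps_subst f g).
Proof.
move=> hf m mN; rewrite (fps_substE (s := [::])) ?big_nil // => a.
have [aN|Na] := ltnP (mdeg a) N; first by rewrite hf // mul0r eqxx.
by rewrite (ford_gpow hg) ?mulr0 ?eqxx // (leq_trans mN).
Qed.

Lemma fps_subst_ftrunc N f :
  fps_subst (ftrunc N f) g = \sum_(a <- monoms N) fps_const _ (fcoef f a)
    * gpow g a.
Proof.
rewrite fps_subst_sum; apply: eq_bigr => a _.
by rewrite fps_subst_constM fps_subst_mon.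
Qed.

Lemma ford_subst_ftrunc N f : ford N (fps_subst f g - fps_subst (ftrunc N f) g).
Proof.
have -> : fps_subst f g = fps_subst (f - ftrunc N f)
  g + fps_subst (ftrunc N f) g.
  by rewrite -fps_substD subrK.
by rewrite addrK; apply/ford_subst/ford_ftrunc.
Qed.

(** On monomials this is [gpowM], hence it holds for the finite truncations; the errors have order
    at least N, for every N. *)
Lemma fps_substM f h : fps_subst (f * h) g = fps_subst f g * fps_subst h g.
Proof.
apply: fordP => N.
pose f0 := ftrunc N f; pose h0 := ftrunc N h.
have E : fps_subst (f0 * h0) g = fps_subst f0 g * fps_subst h0 g.
  rewrite !fps_subst_ftrunc /f0 /h0 /ftrunc !mulr_suml fps_subst_sum.
  apply: eq_bigr => a _; rewrite !mulr_sumr fps_subst_sum;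
    apply: eq_bigr => b _.
  by rewrite mulrACA -fmonM -rmorphM /= fps_subst_constM fps_subst_mon gpowM
    rmorphM
    /= mulrACA.
have -> : fps_subst (f * h) g - fps_subst f g * fps_subst h g =
   fps_subst (f * h - f0 * h0) g
   - ((fps_subst f g - fps_subst f0 g) * fps_subst h g
      + fps_subst f0 g * (fps_subst h g - fps_subst h0 g)).
  rewrite mulrBl mulrBr addrA subrK opprB -E addrA -fps_substD.
  by rewrite subrK.
apply: fordB; last first.
  by apply: fordD; [apply: fordMl | apply: fordMr]; apply: ford_subst_ftrunc.
apply: ford_subst.
have -> : f * h - f0 * h0 = (f - f0) * h + f0 * (h - h0).
  by rewrite mulrBl mulrBr addrA subrK.
by apply: fordD; [apply: fordMl | apply: fordMr]; apply: ford_ftrunc.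
Qed.

End Hom.
End Subst.

Section SubstMorphism.
Variables (n : nat) (I : choiceType) (R : comNzRingType).

(* Truncating the constant terms makes the substitution a ring morphism for
   every family g. *)
Definition sb : ('I_n -> fps I R) -> fps 'I_n R -> fps I R :=
  locked_with fps_key (fun g f => fps_subst f (fun i => trunc0 (g i))).

Arguments sb : simpl never.

Lemma sb_def g f : sb g f = fps_subst f (fun i => trunc0 (g i)).
Proof. by rewrite /sb unlock. Qed.

Variable g : 'I_n -> fps I R.

Let hg i : ford 1 (trunc0 (g i)).
Proof. exact: ford_trunc0. Qed.

Lemma sb_is_nmod_morphism : nmod_morphism (sb g).
Proof. by split=> [|f h]; rewrite !sb_def;
  [apply: fps_subst0 | apply: fps_substD]. Qed.

Lemma sb_is_monoid_morphism : monoid_morphism (sb g).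
Proof.
split=> [|f h]; last by rewrite !sb_def; apply: fps_substM.
by rewrite -fmon1 sb_def fps_subst_mon // /gpow big1 // => i _;
  rewrite cm1 expr0.
Qed.

HB.instance Definition _ := GRing.isNmodMorphism.Build (fps 'I_n R) (fps I R)
  (sb g) sb_is_nmod_morphism.
HB.instance Definition _ := GRing.isMonoidMorphism.Build (fps 'I_n R) (fps I R)
  (sb g) sb_is_monoid_morphism.

Lemma sb_const (c : R) : sb g (fps_const _ c) = fps_const _ c.
Proof.
by rewrite -[fps_const _ c]mulr1 sb_def fps_subst_constM -sb_def rmorph1 mulr1.
Qed.

Lemma ford_sb N f : ford N f -> ford N (sb g f).
Proof. by rewrite sb_def; apply: ford_subst. Qed.

Lemma fcst_sb f : fcst (sb g f) = fcst f.
Proof.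
have -> : sb g f = sb g (trunc0 f) + fps_const _ (fcst f).
  by rewrite -(sb_const (fcst f)) -rmorphD /= subrK.
rewrite rmorphD /= fcst_const -[RHS]add0r; congr (_ + _).
exact/ford1P/ford_sb/ford_trunc0.
Qed.

Lemma sb_var i : fcst (g i) = 0 -> sb g (fX R i) = g i.
Proof.
move=> h; rewrite fvarE sb_def fps_subst_mon // /gpow (bigD1 i) //= cmUU expr1.
rewrite trunc0_id // big1 ?mulr1 // => j ji.
by rewrite cmU eq_sym (negPf ji) expr0.
Qed.

Lemma sbE f : (forall i, fcst (g i) = 0) -> fps_subst f g = sb g f.
Proof.
by move=> h; rewrite sb_def; congr fps_subst; apply: funext => i;
  rewrite trunc0_id.
Qed.

End SubstMorphism.
Arguments sb : simpl never.

Lemma eq_sb n (I : choiceType) (R : comNzRingType) (g g' : 'I_n ->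
  fps I R) : g =1 g' -> sb g =1 sb g'.
Proof. by move=> /funext ->. Qed.

Section HomCompat.
Variables (L R S : comNzRingType) (I J : choiceType).
Variables (i0 : L -> R) (i1 : L -> S) (phi : {rmorphism fps I R -> fps J S}).
Hypothesis phi_const : forall c, phi (fps_const _ (i0 c)) = fps_const _ (i1 c).
Hypothesis phi_ord : forall N f, ford N f -> ford N (phi f).

(** Continuity for the degree filtration carries the morphism through the infinite sum. The two
    coefficient maps [i0] and [i1] let one lemma cover composition of substitutions, change of
    coefficients and [unroll]. *)
Lemma morph_subst n (f : fps 'I_n L) (g : 'I_n -> fps I R) :
  (forall i, ford 1 (g i)) ->
  phi (fps_subst (fps_map i0 f) g) =
    fps_subst (fps_map i1 f) (fun i => phi (g i)).
Proof.
move=> hg; apply: fordP => N.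
have hg' i : ford 1 (phi (g i)) by apply: phi_ord.
have E : phi (fps_subst (ftrunc N (fps_map i0 f)) g)
         = fps_subst (ftrunc N (fps_map i1 f)) (fun i => phi (g i)).
  rewrite !fps_subst_ftrunc // rmorph_sum; apply: eq_bigr => a _.
  rewrite rmorphM /= phi_const; congr (_ * _).
  by rewrite rmorph_prod; apply: eq_bigr => i _; rewrite rmorphXn.
rewrite -[X in X - _](subrK (phi (fps_subst (ftrunc N (fps_map i0 f)) g))).
rewrite -addrA; apply: fordD; last first.
  by rewrite E -opprB; apply/fordN/ford_subst_ftrunc.
by rewrite -rmorphB; apply/phi_ord/ford_subst_ftrunc.
Qed.
End HomCompat.

Lemma fps_map_id I R (f : fps I R) : fps_map id f = f.
Proof. exact: fpsP. Qed.

Lemma sb_sb n k (I : choiceType) (R : comNzRingType) (h : 'I_k -> fps I R)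
    (g : 'I_n -> fps 'I_k R) f :
  sb h (sb g f) = sb (fun i => sb h (g i)) f.
Proof.
rewrite (sb_def g) -[f in fps_subst f]fps_map_id.
rewrite (morph_subst (i1 := id) (sb_const h) (@ford_sb _ _ _ h)); last first.
  by move=> i; apply: ford_trunc0.
rewrite fps_map_id [RHS]sb_def; congr fps_subst; apply: funext => i.
by rewrite /trunc0 rmorphB /= sb_const fcst_sb.
Qed.

Lemma gpow_var n (R : comNzRingType) a :
  gpow (fun i : 'I_n => fX R i) a = fmon a.
Proof.
have monX i k : fX R i ^+ k = fmon (iter k (mmul (ucm i)) mone).
  elim: k => [|k IH]; first by rewrite expr0 fmon1.
  by rewrite exprS IH fvarE -fmonM.
have iterE i j k : (iter k (mmul (ucm i)) mone : {cmonom 'I_n}) j =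
  (k * (i == j))%N.
  elim: k => [|k IH] /=; first by rewrite cm1.
  by rewrite cmM IH cmU mulSn.
rewrite /gpow; transitivity (fmon (\big[mmul/mone]_(i < n)
    iter (a i) (mmul (ucm i)) mone) : fps 'I_n R).
  rewrite (big_morph fmon (fun x y => fmonM R x y) (fmon1 _ _)).
  by apply: eq_bigr => i _; rewrite monX.
congr fmon; apply/eqP/cmP => j.
rewrite (big_morph (fun m : {cmonom 'I_n} =>
  m j) (cmM j) (cm1 j)) (bigD1 j) //=.
rewrite iterE eqxx muln1 big1 ?addn0 // => i /negPf h.
by rewrite iterE h muln0.
Qed.

Lemma sb_id n (R : comNzRingType) (f : fps 'I_n R) : sb (fX R) f = f.
Proof.
rewrite -sbE; last by move=> i; apply: fcst_var.
apply: fpsP => m; rewrite (fps_substE (s := [:: m])) //.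
- by rewrite big_seq1 gpow_var fcoef_mon eqxx mulr1.
- by move=> i; apply: ford_var.
- move=> a; rewrite gpow_var fcoef_mon inE (eq_sym m).
  by case: (a =P m) => // _; rewrite mulr0 eqxx.
Qed.

(** * Units, and division by x_i - y *)

Section Units.
Variable R : comNzRingType.

Lemma mem_div_ucm (I : choiceType) (i : I) (m : {cmonom I}) :
  (ucm i \in divisors_cm m) = (0 < m i)%N.
Proof.
apply/mem_divisors_cmP/idP => [[l ->]|h]; first by rewrite cmM cmUU.
exists (divcm m (ucm i)); apply/eqP/cmP => j; rewrite cmM divcmE cmU.
by case: eqP => [<-|_]; rewrite ?subn0 // add1n subn1 prednK.
Qed.

(** The inverse is the geometric series [geo] evaluated at 1 - f, which has no constant term. *)
Lemma fps_unit (I : choiceType) (f : fps I R) :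
  fcst f = 1 -> exists h, f * h = 1.
Proof.
move=> f1; have [geo hgeo] : exists geo : fps 'I_1 R, forall m, fcoef geo m = 1.
  by exists (Fps (fun _ => 1)).
have E : (1 - fX R (ord0 : 'I_1)) * geo = 1.
  apply: fpsP => m; rewrite mulrBl mul1r fvarE fcoefB fcoef_monM fcoef1
    mem_div_ucm.
  rewrite !hgeo -mdeg_eq0 mdeg_ordE big_ord1 lt0n.
  by case: eqP => _; rewrite ?subr0 ?subrr.
exists (sb (fun _ => 1 - f) geo).
have h i : fcst ((fun _ : 'I_1 => 1 - f) i) =
  0 by rewrite rmorphB rmorph1 /= f1 subrr.
have {1}<- : sb (fun _ => 1 - f) (1 - fX R (ord0 : 'I_1)) = f.
  by rewrite rmorphB rmorph1 /= sb_var ?subKr // (h ord0).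
by rewrite -rmorphM E rmorph1.
Qed.

Lemma lreg_var (I : choiceType) (i : I) : GRing.lreg (fX R i).
Proof.
apply: mulrI0_lreg => f f0; apply: fpsP => m.
by rewrite -(fcoef_monMl (ucm i)) -fvarE f0 !fcoef0.
Qed.

Variable n : nat.
Implicit Types (i j k : 'I_n) (f y z : fps 'I_n R).

Definition upd i z : 'I_n -> fps 'I_n R :=
  fun k => if k == i then z else fX R k.
Local Notation ev i z := (sb (upd i z)).

Lemma fcst_upd i z k : fcst z = 0 -> fcst (upd i z k) = 0.
Proof. by rewrite /upd; case: eqP => // _ _; apply: fcst_var. Qed.

Lemma ev_var i z k : fcst z = 0 ->
  ev i z (fX R k) = if k == i then z else fX R k.
Proof. by move=> hz; apply: sb_var; apply: fcst_upd. Qed.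

(** Separate the monomials that contain x_i from the rest [f0]: setting x_i = 0 kills the former and
    fixes [f0]. *)
Lemma div_var i f : ev i 0 f = 0 -> exists q, f = fX R i * q.
Proof.
move=> hf; have [q hq] : exists q : fps 'I_n R, forall m,
    fcoef q m = fcoef f (mmul (ucm i) m).
  by exists (Fps (fun m => fcoef f (mmul (ucm i) m))).
have [f0 hf0] : exists f0 : fps 'I_n R, forall m,
    fcoef f0 m = if m i == 0%N then fcoef f m else 0.
  by exists (Fps (fun m => if m i == 0%N then fcoef f m else 0)).
have E : f = fX R i * q + f0.
  apply: fpsP => m; rewrite fcoefD fvarE fcoef_monM mem_div_ucm lt0n hf0 hq.
  case: eqP => [_|mi]; first by rewrite add0r.
  rewrite addr0; congr fcoef; apply/eqP/cmP => j; rewrite cmM divcmE cmU.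
  case: eqP => [<-|_]; rewrite ?subn0 //.
  by rewrite add1n subn1 prednK // lt0n; apply/eqP.
have K : ev i 0 f0 = f0.
  apply: fpsP => m; rewrite -sbE; last by move=> k; rewrite fcst_upd ?rmorph0.
  have G (a : {cmonom _}) : a i = 0%N -> gpow (upd i 0) a = fmon a.
    move=> ai; rewrite -gpow_var; apply: eq_bigr => k _; rewrite /upd.
    by case: eqP => // ->; rewrite ai !expr0.
  rewrite (fps_substE (s := [:: m])) //.
  - rewrite big_seq1 !hf0; case: eqP => h; last by rewrite mul0r.
    by rewrite G // fcoef_mon eqxx mulr1.
  - by move=> k; apply/ford1P; rewrite -/(fcst _) fcst_upd ?rmorph0.
  - move=> a; rewrite hf0; case: (a i =P 0%N) => h; last by rewrite mul0r eqxx.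
    rewrite G // fcoef_mon inE (eq_sym m).
    by case: (a =P m) => // _; rewrite mulr0 eqxx.
exists q; move: hf; rewrite {1}E rmorphD rmorphM /= K ev_var ?rmorph0 //
  eqxx mul0r.
by rewrite add0r => h; rewrite {1}E h addr0.
Qed.

(** Already z = 0 says that y does not involve x_i; the form for all z is the one applied to the
    shifts x_i + y and x_i - y. *)
Definition indep i y := fcst y = 0 /\ forall z, fcst z = 0 -> ev i z y = y.

Lemma ev_comp i z z' f : fcst z = 0 -> fcst z' = 0 ->
  ev i z (ev i z' f) = ev i (ev i z z') f.
Proof.
move=> h h'; rewrite sb_sb; apply: eq_sb => k.
by rewrite {2 3}/upd; case: eqP => // /eqP e;
  rewrite sb_var ?fcst_upd // /upd (negPf e).
Qed.

(* x_i |-> x_i + y is an automorphism that reduces to the case y = 0. *)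
Section Shift.
Variables (i : 'I_n) (y : fps 'I_n R).
Hypothesis hy : indep i y.
Let y0 : fcst y = 0. Proof. by case: hy. Qed.
Let yi z : fcst z = 0 -> ev i z y = y. Proof. by case: hy => _; apply. Qed.

Lemma fcst_xD : fcst (fX R i + y) = 0. Proof.
  by rewrite rmorphD /= fcst_var y0 addr0. Qed.
Lemma fcst_xB : fcst (fX R i - y) = 0. Proof.
  by rewrite rmorphB /= fcst_var y0 subr0. Qed.

Lemma ev_xBK : cancel (ev i (fX R i + y)) (ev i (fX R i - y)).
Proof.
move=> f; rewrite ev_comp ?fcst_xD ?fcst_xB // rmorphD /= yi ?fcst_xB //
  ev_var ?fcst_xB // eqxx.
rewrite subrK -[RHS]sb_id; apply: eq_sb => k; rewrite /upd.
by case: eqP => // ->.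
Qed.

Lemma lreg_xB : GRing.lreg (fX R i - y).
Proof.
apply: mulrI0_lreg => f /(congr1 (ev i (fX R i + y))).
rewrite rmorphM rmorphB rmorph0 /= yi ?fcst_xD // ev_var ?fcst_xD //
  eqxx addrK => /eqP.
rewrite (mulrI_eq0 _ (@lreg_var _ i)) => /eqP h.
by rewrite -(ev_xBK f) h rmorph0.
Qed.

Lemma div_xB f : ev i y f = 0 -> exists q, f = (fX R i - y) * q.
Proof.
move=> hf; have [|q hq] := @div_var i (ev i (fX R i + y) f).
  rewrite ev_comp ?fcst_xD ?rmorph0 // rmorphD /= ev_var ?rmorph0 // eqxx add0r.
  by rewrite yi ?rmorph0.
exists (ev i (fX R i - y) q); rewrite -[LHS]ev_xBK hq rmorphM /=.
by rewrite ev_var ?fcst_xB // eqxx.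
Qed.

Lemma div_sub_ev f : exists q, f - ev i y f = (fX R i - y) * q.
Proof. by apply: div_xB; rewrite rmorphB /= ev_comp // yi // subrr. Qed.
End Shift.

Lemma indep_var i k : k != i -> indep i (fX R k).
Proof.
move=> ki; split=> [|z z0]; first exact: fcst_var.
by rewrite ev_var // (negPf ki).
Qed.

End Units.

(** * Sums of fractions *)

Section Fractions.
Variable A : comNzRingType.
Local Notation sof := (@is_sum_of_fractions A _).

Lemma lreg_prod (T : Type) (s : seq T) (P : pred T) (F : T -> A) :
  (forall t, P t -> GRing.lreg (F t)) -> GRing.lreg (\prod_(t <- s | P t) F t).
Proof.
by move=> h; apply: (big_ind (@GRing.lreg A)) => //;
  [apply: GRing.lreg1 | apply: GRing.lregM].
Qed.

Lemma lreg_mull (x y : A) : GRing.lreg (x * y) -> GRing.lreg x.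
Proof. by rewrite mulrC; apply: GRing.lregMl. Qed.

Section Basic.
Variable T : finType.
Implicit Types (N D K : T -> A) (m : nat) (f g C : A).

(** Any regular common multiple C of the denominators, with cofactors K, can replace their product:
    the relation is proved after multiplication by C. *)
Lemma sof_common N D m f C K : GRing.lreg C -> (forall t, C = D t * K t) ->
  m%:R * C * f = \sum_t N t * K t -> sof m N D f.
Proof.
move=> hC hK hf; rewrite /is_sum_of_fractions; apply: hC.
transitivity (\prod_t D t * (m%:R * C * f)); first by ring.
rewrite hf !mulr_sumr; apply: eq_bigr => t _.
by rewrite (bigD1 t) //= (hK t); ring.
Qed.

Lemma sof_eq_frac N D N' D' m f : (forall t, GRing.lreg (D t)) ->
  (forall t, N t * D' t = N' t * D t) -> sof m N D f -> sof m N' D' f.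
Proof.
move=> hD hN hf; have: GRing.lreg (\prod_t D t) by apply: lreg_prod.
apply; transitivity (\prod_t D' t * (m%:R * \prod_t D t * f)); first by ring.
rewrite hf !mulr_sumr; apply: eq_bigr => t _.
rewrite (bigD1 t) //= [in RHS](bigD1 t) //=.
set P := \prod_(_ | _) _; set Q := \prod_(_ | _) _.
by transitivity (N t * D' t * (P * Q)); [ring | rewrite hN; ring].
Qed.

Lemma sof_unique N D f g : (forall t, GRing.lreg (D t)) ->
  sof 1 N D f -> sof 1 N D g -> f = g.
Proof.
move=> hD hf hg; have: GRing.lreg (\prod_t D t) by apply: lreg_prod.
by apply; move: hf hg; rewrite /is_sum_of_fractions !mul1r => -> ->.
Qed.

Lemma sofB N N' D f g : sof 1 N D f -> sof 1 N' D g ->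
  sof 1 (fun t => N t - N' t) D (f - g).
Proof.
rewrite /is_sum_of_fractions mulrBr => -> ->; rewrite -sumrB.
by apply: eq_bigr => t _; rewrite mulrBl.
Qed.

Lemma sofZ N D c f : sof 1 N D f -> sof 1 (fun t => c * N t) D (c * f).
Proof.
rewrite /is_sum_of_fractions mulrCA => ->; rewrite mulr_sumr.
by apply: eq_bigr => t _; rewrite mulrA.
Qed.

Lemma eq_sof N N' D D' m f : N =1 N' -> D =1 D' -> sof m N D f -> sof m N' D' f.
Proof. by move=> /funext -> /funext ->. Qed.

Lemma prod_split2 D k l : k != l ->
  \prod_t D t = D k * D l * \prod_(t | (t != k) && (t != l)) D t.
Proof. by move=> kl; rewrite (bigD1 k) //= (bigD1 l) 1?eq_sym //= mulrA. Qed.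

(** Isolates the two terms whose poles along x_k = x_l are to be merged. *)
Lemma sum_split2 N D k l : k != l ->
  \sum_t N t * \prod_(s | s != t) D s =
  (N k * D l + N l * D k) * \prod_(t | (t != k) && (t != l)) D t
  + D k * D l * \sum_(t | (t != k) && (t != l))
                  N t * \prod_(s | [&& s != k, s != l & s != t]) D s.
Proof.
move=> kl; have lk : l != k by rewrite eq_sym.
set P := \prod_(t | (t != k) && _) _.
have E1 : \prod_(s | s != k) D s = D l * P by rewrite (bigD1 l).
have E2 : \prod_(s | s != l) D s = D k * P.
  by rewrite (bigD1 k) //=; congr (_ * _); apply: eq_bigl => t; rewrite andbC.
rewrite [LHS](bigD1 k) //= E1; rewrite [X in _ + X](bigD1 l) //= E2.
rewrite addrA mulrDl !mulrA; congr (_ + _).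
rewrite mulr_sumr; apply: eq_bigr => t /andP[tk tl].
rewrite (bigD1 k) 1?eq_sym //= (bigD1 l) /=; last by rewrite lk eq_sym tl.
rewrite (eq_bigl (fun s => [&& s != k, s != l & s != t])) //; last first.
  by move=> s; case: (s == t); case: (s == k); case: (s == l).
by ring.
Qed.

(** Once the terms k and l are gone, giving them the fraction 0 / 1 keeps the sum indexed by the
    whole type. *)
Lemma sof_drop2 N D k l f : k != l ->
  (\prod_(t | (t != k) && (t != l)) D t) * f =
  \sum_(t | (t != k) && (t != l))
     N t * \prod_(s | [&& s != k, s != l & s != t]) D s ->
  sof 1 (fun t => if (t != k) && (t != l) then N t else 0)
        (fun t => if (t != k) && (t != l) then D t else 1) f.
Proof.
move=> kl h; rewrite /is_sum_of_fractions (sum_split2 _ _ kl)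
  (prod_split2 _ kl) !eqxx andbF /=.
rewrite !mul0r addr0 mul0r add0r !mul1r.
rewrite (eq_bigr D) => [|t ->] //; rewrite h; apply: eq_bigr => t -> .
by congr (_ * _); apply: eq_bigr => s /and3P[-> ->].
Qed.

End Basic.

Lemma sof_reindex (T U : finType) (h : T -> U) (N D : U -> A) m f :
  bijective h -> sof m (N \o h) (D \o h) f -> sof m N D f.
Proof.
move=> bh; rewrite /is_sum_of_fractions (reindex h (onW_bij _ bh)) //= => ->.
rewrite [RHS](reindex h (onW_bij _ bh)) //=; apply: eq_bigr => t _;
  congr (_ * _).
rewrite [RHS](reindex h (onW_bij _ bh)) //=.
by apply: eq_bigl => s; rewrite (bij_eq bh).
Qed.

(** Expanding the inner sums [p t] gives one sum over pairs; in this way n + 1 sums over S_n make up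
    a sum over S_(n+1). *)
Lemma sof_nested (T U : finType) (K D p : T -> A) (N2 D2 : T -> U -> A) m f :
  (forall t, GRing.lreg (D t)) -> (forall t u, GRing.lreg (D2 t u)) ->
  sof 1 (fun t => K t * p t) D f -> (forall t, sof m (N2 t) (D2 t) (p t)) ->
  sof m (fun x : T * U => K x.1 * N2 x.1 x.2) (fun x => D x.1 * D2 x.1 x.2) f.
Proof.
move=> hD hD2 hf hp; pose P t := \prod_u D2 t u.
have rP t : GRing.lreg (P t) by apply: lreg_prod.
apply: (sof_common (C := (\prod_t D t) * \prod_t P t)
  (K := fun x => (\prod_(t | t != x.1) D t) * (\prod_(t | t != x.1) P t)
    * \prod_(u | u != x.2) D2 x.1 u)).
- by apply: GRing.lregM; apply: lreg_prod.
- move=> [t u] /=; rewrite (bigD1 t) //= [\prod_t P t](bigD1 t) //=.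
  by rewrite [in LHS]/P (bigD1 u) //=; ring.
transitivity (m%:R * (\prod_t P t) * (1%:R * \prod_t D t * f)); first by ring.
rewrite hf mulr_sumr.
rewrite -(pair_bigA _ (fun t u => K t * N2 t u * ((\prod_(s | s != t) D s) *
  (\prod_(s | s != t) P s) * \prod_(v | v != u) D2 t v))) /=.
apply: eq_bigr => t _.
transitivity (K t * (\prod_(s | s != t) D s) * (\prod_(s | s != t) P s)
  * (m%:R * P t * p t)); first by rewrite [\prod_t P t](bigD1 t) //=; ring.
rewrite hp mulr_sumr; apply: eq_bigr => u _; ring.
Qed.

End Fractions.

Lemma sof_morph (A B : comNzRingType) (phi : {rmorphism A -> B}) (T : finType)
    m (N D : T -> A) f : is_sum_of_fractions m N D f ->
  is_sum_of_fractions m (fun t => phi (N t)) (fun t => phi (D t)) (phi f).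
Proof.
rewrite /is_sum_of_fractions => /(congr1 phi).
rewrite !rmorphM rmorph_nat rmorph_prod rmorph_sum => ->.
by apply: eq_bigr => t _; rewrite rmorphM rmorph_prod.
Qed.

(** * Formal group laws *)

Section Operations.
Variable R : comNzRingType.

Definition pair_fun (I : choiceType) (f g : fps I R) (i : 'I_2) :=
  if val i == 0%N then f else g.

Definition eval2 (G : fps 'I_2 R) (I : choiceType) (f g : fps I R) :=
  sb (pair_fun f g) G.

Definition triple_fun (I : choiceType) (f g h : fps I R) (i : 'I_3) :=
  if val i == 0%N then f else if val i == 1%N then g else h.

Lemma fcst0 (I : choiceType) : fcst (0 : fps I R) = 0.
Proof. exact: rmorph0. Qed.

Lemma sb_eval2 (I : choiceType) n (h : 'I_n -> fps I R) G f g :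
  sb h (eval2 G f g) = eval2 G (sb h f) (sb h g).
Proof. by rewrite /eval2 sb_sb; apply: eq_sb => i; rewrite /pair_fun;
  case: eqP. Qed.

Lemma sb_comp1 (I : choiceType) n (h : 'I_n -> fps I R) (w : fps 'I_1 R) f :
  sb h (sb (fun=> f) w) = sb (fun=> sb h f) w.
Proof. by rewrite sb_sb. Qed.

Lemma sb_triple (I : choiceType) n (h : 'I_n -> fps I R) G f g k :
  sb h (sb (triple_fun f g k) G) = sb (triple_fun (sb h f) (sb h g) (sb h k)) G.
Proof. by rewrite sb_sb; apply: eq_sb => i; rewrite /triple_fun;
  do 2!case: eqP => //. Qed.

Lemma fcst_pair_fun (I : choiceType) (f g : fps I R) i :
  fcst f = 0 -> fcst g = 0 -> fcst (pair_fun f g i) = 0.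
Proof. by rewrite /pair_fun; case: eqP. Qed.

Lemma fcst_triple_fun (I : choiceType) (f g h : fps I R) i :
  fcst f = 0 -> fcst g = 0 -> fcst h = 0 -> fcst (triple_fun f g h i) = 0.
Proof. by rewrite /triple_fun; do 2!case: eqP => //. Qed.

Variables (F : fps 'I_2 R) (chi : fps 'I_1 R).

Definition fgl_axioms :=
  [/\ eval2 F (fX R (lift ord0 ord0)) (fX R ord0) = F :> fps 'I_2 R,
      eval2 F (fX R ord0) 0 = fX R ord0 :> fps 'I_1 R,
      fcst chi = 0 & eval2 F (fX R ord0) chi = 0 :> fps 'I_1 R].

Hypothesis hF : fgl_axioms.

Definition fneg (I : choiceType) (f : fps I R) := sb (fun _ : 'I_1 => f) chi.

Lemma fcst_fneg (I : choiceType) (f : fps I R) : fcst (fneg f) = 0.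
Proof. by rewrite fcst_sb; case: hF. Qed.

Lemma sb_fneg (I : choiceType) n (h : 'I_n ->
  fps I R) f : sb h (fneg f) = fneg (sb h f).
Proof. exact: sb_comp1. Qed.

Section Laws.
Variable I : choiceType.
Implicit Types f g h : fps I R.

Lemma faddC f g : fcst f = 0 -> fcst g = 0 -> eval2 F f g = eval2 F g f.
Proof.
move=> f0 g0; case: hF => h _ _ _; rewrite -{1}h /eval2 sb_sb.
have p0 i : fcst (pair_fun f g i) = 0 by apply: fcst_pair_fun.
by apply: eq_sb => i; rewrite /pair_fun; case: eqP => _; rewrite sb_var.
Qed.

Lemma fadd0 f : fcst f = 0 -> eval2 F f 0 = f.
Proof.
move=> f0; case: hF => _ /(congr1 (sb (fun _ => f))) + _ _.
by rewrite sb_eval2 rmorph0 sb_var.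
Qed.

Lemma fadd0r f : fcst f = 0 -> eval2 F 0 f = f.
Proof. by move=> f0; rewrite faddC ?fcst0 // fadd0. Qed.

Lemma faddN f : fcst f = 0 -> eval2 F f (fneg f) = 0.
Proof.
move=> f0; case: hF => _ _ _ /(congr1 (sb (fun _ => f))).
by rewrite sb_eval2 rmorph0 sb_var.
Qed.

End Laws.

(** [D1] is the difference quotient of F in its second argument. As F(0, z) = z, its constant term
    is 1, which makes it a unit under every substitution. *)
Lemma fadd_diff : exists2 D1 : fps 'I_3 R, fcst D1 = 1 &
  forall (I : choiceType) (f g h : fps I R),
    fcst f = 0 -> fcst g = 0 -> fcst h = 0 ->
    eval2 F f g - eval2 F f h = (g - h) * sb (triple_fun f g h) D1.
Proof.
pose i0 : 'I_3 := ord0; pose i1 : 'I_3 := lift ord0 ord0.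
pose i2 : 'I_3 := lift ord0 (lift ord0 ord0).
have [D1 hD] := div_sub_ev (@indep_var R 3 i1 i2 isT) (eval2 F (fX R i0)
  (fX R i1)).
have D1P (I : choiceType) (f g h : fps I R) :
    fcst f = 0 -> fcst g = 0 -> fcst h = 0 ->
    eval2 F f g - eval2 F f h = (g - h) * sb (triple_fun f g h) D1.
  move=> f0 g0 h0; have t0 i : fcst (triple_fun f g h i) =
    0 by apply: fcst_triple_fun.
  move: hD => /(congr1 (sb (triple_fun f g h))).
  by rewrite sb_eval2 !ev_var ?fcst_var //
    rmorphB rmorphM rmorphB /= !sb_eval2 !sb_var.
exists D1 => //.
have := @D1P 'I_1 0 (fX R ord0) 0;
  rewrite fcst0 fcst_var => /(_ erefl erefl erefl).
rewrite fadd0r ?fcst_var // fadd0 ?fcst0 // subr0 -{1}[fX R ord0]mulr1.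
by move=> /lreg_var /(congr1 (@fcst _ _)); rewrite fcst_sb rmorph1 => <-.
Qed.

(** Both f and the double inverse are inverses of \bar f, and they coincide because the difference
    quotient of F(\bar f, -) is a unit. *)
Lemma fnegK (I : choiceType) (f : fps I R) : fcst f = 0 -> fneg (fneg f) = f.
Proof.
move=> f0; have [D1 D1c D1P] := fadd_diff.
have nf0 := fcst_fneg f; have nnf0 := fcst_fneg (fneg f).
have := D1P I (fneg f) f (fneg (fneg f)) nf0 f0 nnf0.
rewrite faddN // faddC // faddN // subr0.
have [e he] : exists e, sb (triple_fun (fneg f) f (fneg (fneg f))) D1 * e = 1.
  by apply: fps_unit; rewrite fcst_sb.
move=> /(congr1 (fun u => u * e)); rewrite mul0r -mulrA he mulr1 => /esym/eqP.
by rewrite subr_eq0 => /eqP.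
Qed.

(* C(x,y) = (x - y) / (x +_F \bar y), and Q(x,t) is the quotient by t +_F t of
   (x +_F t) C(x,t) - (x - t), which by itself need not be unique. *)
Lemma fgl_quotients : exists C Q : fps 'I_2 R,
  forall (I : choiceType) (f g : fps I R), fcst f = 0 -> fcst g = 0 ->
  [/\ f - g = eval2 F f (fneg g) * eval2 C f g,
      eval2 F f g * eval2 C f g - (f - g) = eval2 F g g * eval2 Q f g &
      eval2 Q f f = eval2 C f f].
Proof.
pose x : fps 'I_2 R := fX R ord0; pose y : fps 'I_2 R := fX R (lift ord0 ord0).
have x0 : fcst x = 0 by apply: fcst_var.
have y0 : fcst y = 0 by apply: fcst_var.
(* x +_F \bar y vanishes at x = y, so it is (x - y) v; setting y = 0 shows that v has constant term
   1, and C is its inverse. *)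
have [|v hv] := @div_xB R 2 ord0 y (@indep_var R 2 ord0 (lift ord0 ord0) isT)
  (eval2 F x (fneg y)).
  by rewrite sb_eval2 sb_fneg !ev_var //= faddN.
have v1 : fcst v = 1.
  have := congr1 (sb (pair_fun (fX R (ord0 : 'I_1)) 0)) hv.
  rewrite sb_eval2 sb_fneg rmorphM rmorphB /=.
  have pz i : fcst (pair_fun (fX R (ord0 : 'I_1)) 0 i) = 0.
    by apply: fcst_pair_fun; rewrite ?fcst_var ?fcst0.
  rewrite !sb_var // /pair_fun /= /fneg.
  have -> : sb (fun=> 0) chi = 0 :> fps 'I_1 R.
    have := @faddN 'I_1 0 (fcst0 _).
    by rewrite fadd0r ?fcst_fneg.
  rewrite fadd0 ?fcst_var // subr0 -{1}[fX R ord0]mulr1.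
  by move=> /lreg_var /(congr1 (@fcst _ _)); rewrite fcst_sb rmorph1 => <-.
have [C hC] := fps_unit v1.
have [D1 D1c D1P] := fadd_diff.
pose u : fps 'I_1 R := fX R ord0.
have [e he] : exists e, sb (triple_fun u u (fneg u)) D1 * e = 1.
  by apply: fps_unit; rewrite fcst_sb.
(* By [fadd_diff], (x +_F y) - (x +_F \bar y) = (y - \bar y) D1(x, y, \bar y), while y +_F y = (y -
   \bar y) D1(y, y, \bar y). The quotient is thus C(x, y) D1(x, y, \bar y) / D1(y, y, \bar y), which
   equals C at x = y; [e] inverts the last factor. *)
pose Q := C * sb (triple_fun x y (fneg y)) D1 * sb (fun=> y) e.
exists C, Q => I f g f0 g0; have p0 i : fcst (pair_fun f g i) =
  0 by apply: fcst_pair_fun.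
have sx : sb (pair_fun f g) x = f by rewrite sb_var.
have sy : sb (pair_fun f g) y = g by rewrite sb_var.
have hc : f - g = eval2 F f (fneg g) * eval2 C f g.
  have := congr1 (fun z => sb (pair_fun f g) (z * C)) hv.
  rewrite -mulrA hC mulr1 rmorphM rmorphB /= sb_eval2 sb_fneg sx sy.
  by move=> <-.
have QE (J : choiceType) (f' g' : fps J R) : fcst f' = 0 -> fcst g' = 0 ->
    eval2 Q f' g' = eval2 C f' g' * sb (triple_fun f' g' (fneg g'))
      D1 * sb (fun=> g') e.
  move=> h1 h2; have q0 i : fcst (pair_fun f' g' i) = 0 by apply: fcst_pair_fun.
  by rewrite /eval2 /Q !rmorphM /= sb_triple sb_comp1 sb_fneg !sb_var.
have eE (J : choiceType) (z : fps J R) : fcst z = 0 ->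
    sb (triple_fun z z (fneg z)) D1 * sb (fun=> z) e = 1.
  move=> z0; have := congr1 (sb (fun=> z)) he.
  by rewrite rmorphM rmorph1 /= sb_triple sb_fneg sb_var.
split=> //; last by rewrite QE // -mulrA eE // mulr1.
rewrite hc -mulrBl D1P ?fcst_fneg // QE //.
have -> : eval2 F g g = (g - fneg g) * sb (triple_fun g g (fneg g)) D1.
  by rewrite -D1P ?fcst_fneg // faddN // subr0.
transitivity ((g - fneg g) * eval2 C f g * sb (triple_fun f g (fneg g)) D1
  * (sb (triple_fun g g (fneg g)) D1 * sb (fun=> g) e));
    first by rewrite eE // mulr1; ring.
ring.
Qed.

End Operations.

(** * Lagrange sums *)

Section Lagrange.
Variables (R : comNzRingType) (n : nat).
Implicit Types (i j k l : 'I_n) (f g p : fps 'I_n R) (M : 'I_n -> fps 'I_n R).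
Local Notation x i := (fX R i).
Local Notation ev i z := (sb (upd i z)).

Lemma lreg_subx i j : i != j -> GRing.lreg (x i - x j).
Proof. by move=> ij; apply/lreg_xB/indep_var; rewrite eq_sym. Qed.

Lemma ev_x i j k : ev i (x j) (x k) = x (if k == i then j else k).
Proof. by rewrite ev_var ?fcst_var //; case: eqP. Qed.

(** One factor is removed at a time: the quotient still vanishes at the other coincidences x_i =
    x_j, because there the removed factor stays regular. *)
Lemma divide_prod (s : seq ('I_n * 'I_n)) f :
  uniq s -> {in s, forall e, e.1 != e.2} ->
  {in s &, forall e e', e != e' ->
     GRing.lreg (ev e.1 (x e.2) (x e'.1 - x e'.2))} ->
  {in s, forall e, ev e.1 (x e.2) f = 0} ->
  exists q, f = (\prod_(e <- s) (x e.1 - x e.2)) * q.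
Proof.
elim: s f => [|e s IH] f /=; first by exists f; rewrite big_nil mul1r.
move=> /andP[es us] ne he hf.
have ein : e \in e :: s by rewrite mem_head.
have sin u : u \in s -> u \in e :: s by rewrite inE orbC => ->.
have [|f1 hf1] := div_xB (@indep_var R n e.1 e.2 _) (hf e ein).
  by rewrite eq_sym ne.
have [||||q hq] := IH f1 => //.
- by move=> u us'; apply/ne/sin.
- by move=> u v us' vs'; apply: he; apply: sin.
- move=> u us'; have := hf u (sin _ us'); rewrite hf1 rmorphM /=.
  have ue : u != e by apply: contraNneq es => <-.
  by move=> h; apply: (he _ _ (sin _ us') ein ue); rewrite h mulr0.
by exists q; rewrite big_cons -mulrA -hq.
Qed.

Definition var_den i := \prod_(j | j != i) (x i - x j).

Lemma lreg_var_den i : GRing.lreg (var_den i).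
Proof. by apply: lreg_prod => j ji; apply: lreg_subx; rewrite eq_sym. Qed.

(** On the locus x_i = x_j either variable may be eliminated in favour of the other. *)
Lemma ev_switch i j f : ev j (x i) (ev i (x j) f) = ev j (x i) f.
Proof.
rewrite sb_sb; apply: eq_sb => k; rewrite {2}/upd; case: (k =P i) => [->|ki].
  by rewrite ev_x eqxx /upd; case: eqP => // ->.
by rewrite ev_x /upd; case: eqP.
Qed.

Lemma ev_eq_switch i j f g : ev i (x j) f = ev i (x j) g ->
  ev j (x i) f = ev j (x i) g.
Proof. by move=> h; rewrite -ev_switch h ev_switch. Qed.

(** Take the Vandermonde product E as common denominator, E = [var_den i] * K i. At x_k = x_l every
    K i with i different from k and l vanishes, and so does K k + K l; as M k and M l agree there,
    \sum_i M i * K i vanishes and E divides it. *)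
Lemma lagrange_sum M :
  (forall i j, i != j -> ev i (x j) (M i) = ev i (x j) (M j)) ->
  exists p, is_sum_of_fractions 1 M var_den p.
Proof.
move=> hM; pose s0 := enum [pred e : 'I_n * 'I_n | (e.1 < e.2)%N].
have s0P (e : 'I_n * 'I_n) : (e \in s0) = (e.1 < e.2)%N by rewrite mem_enum inE.
pose E := \prod_(e <- s0) (x e.1 - x e.2).
have evE i j : i != j -> ev i (x j) E = 0.
  move=> ij; suff [e es he] : exists2 e,
    e \in s0 & ev i (x j) (x e.1 - x e.2) = 0.
    by rewrite /E (bigD1_seq e) ?enum_uniq //= rmorphM /= he mul0r.
  have [lt|lt|eq] := ltngtP i j; last by rewrite (val_inj eq) eqxx in ij.
  - exists (i, j); rewrite ?s0P // rmorphB /= !ev_x eqxx.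
    by case: (j =P i) => _; rewrite subrr.
  - exists (j, i); rewrite ?s0P // rmorphB /= !ev_x eqxx.
    by case: (j =P i) => _; rewrite subrr.
have lregE : GRing.lreg E.
  rewrite /E big_seq; apply: lreg_prod => e; rewrite s0P => lt.
  by apply: lreg_subx; rewrite -(inj_eq val_inj) ltn_eqF.
have /fin_all_exists[K hK] i : exists K, E = var_den i * K.
  have [||||q hq] := @divide_prod [seq (i, j) | j <- enum (predC1 i)] E.
  - by rewrite map_inj_uniq ?enum_uniq // => j j' [].
  - by move=> e /mapP[j]; rewrite mem_enum inE => ji -> /=; rewrite eq_sym.
  - move=> e e' /mapP[j _ ->] /mapP[j' + ->] /=; rewrite mem_enum inE => j'i ne.
    rewrite rmorphB /= !ev_x eqxx (negPf j'i); apply: lreg_subx.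
    by apply: contraNneq ne => ->.
  - move=> e /mapP[j + ->] /=; rewrite mem_enum inE => ji.
    by apply: evE; rewrite eq_sym.
  by exists q; rewrite {1}hq big_map big_enum.
have [||||p hp] := @divide_prod s0 (\sum_i M i * K i).
- exact: enum_uniq.
- by move=> e; rewrite s0P => lt; rewrite -(inj_eq val_inj) ltn_eqF.
(* Each pair is listed in increasing order, so x_i := x_j kills x_k - x_l only for the pair (i, j)
   itself. *)
- move=> [i j] [k l]; rewrite !s0P /= => ij kl ne.
  rewrite rmorphB /= !ev_x; apply: lreg_subx.
  case: (k =P i) => [ki|_]; case: (l =P i) => [li|_].
  + by move: kl; rewrite ki li ltnn.
  + by apply: contraNneq ne => jl; rewrite ki jl.
  + by rewrite -(inj_eq val_inj) ltn_eqF // (ltn_trans kl) // li.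
  + by rewrite -(inj_eq val_inj) ltn_eqF.
- move=> [k l]; rewrite s0P /= => lt.
  have kl : k != l by rewrite -(inj_eq val_inj) ltn_eqF.
  have lk : l != k by rewrite eq_sym.
  rewrite rmorph_sum /= (bigD1 k) //= (bigD1 l) //= big1 ?addr0.
    rewrite !rmorphM /= hM // -mulrDr.
    pose D t := \prod_(j | (j != k) && (j != l)) (x t - x j).
    have Dk : var_den k = (x k - x l) * D k by rewrite /var_den (bigD1 l).
    have Dl : var_den l = (x l - x k) * D l.
      rewrite /var_den (bigD1 k) //=; congr (_ * _).
      by apply: eq_bigl => j; rewrite andbC.
    have sD t : t \in [:: k; l] -> ev k (x l) (D t) = D l.
      rewrite !inE => tkl; rewrite rmorph_prod;
        apply: eq_bigr => j /andP[jk jl].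
      rewrite rmorphB /= !ev_x (negPf jk).
      by case/orP: tkl => /eqP ->; rewrite ?eqxx ?(negPf lk).
    (* E is (x_k - x_l) D_k K_k and also -(x_k - x_l) D_l K_l; cancelling x_k - x_l leaves this
       relation, and D_k = D_l at x_k = x_l. *)
    have h : D k * K k + D l * K l = 0.
      apply: (lreg_subx kl); rewrite mulr0; apply/eqP.
      rewrite mulrDr !mulrA -Dk -hK -(opprB (x l)) mulNr -Dl mulNr -hK.
      by rewrite subrr.
    have /(congr1 (ev k (x l))) := h.
    rewrite rmorphD !rmorphM rmorph0 /= !sD ?inE ?eqxx ?orbT // -mulrDr => h0.
    have -> : ev k (x l) (K k) + ev k (x l) (K l) = 0.
      suff: GRing.lreg (D l) by apply; rewrite h0 mulr0.
      by apply: lreg_prod => j /andP[_ jl]; apply: lreg_subx; rewrite eq_sym.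
    by rewrite mulr0.
  move=> i /andP[ik il]; rewrite rmorphM /=.
  have -> : ev k (x l) (K i) = 0.
    suff: GRing.lreg (ev k (x l) (var_den i)).
      by apply; rewrite mulr0 -rmorphM -hK /= evE.
    rewrite rmorph_prod; apply: lreg_prod => j ji.
    rewrite rmorphB /= !ev_x (negPf ik); apply: lreg_subx.
    by case: (j =P k) => _ //; rewrite eq_sym.
  by rewrite mulr0.
exists p; apply: (sof_common (C := E) (K := K)) => //.
by rewrite mul1r hp.
Qed.

Lemma ev_tperm i j f : ev i (x j) (sb (fun k => x (tperm i j k)) f) =
  ev i (x j) f.
Proof.
rewrite sb_sb; apply: eq_sb => k; rewrite ev_x /upd.
by case: tpermP => [->|->|/eqP/negPf -> _]; rewrite ?eqxx //; case: eqP.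
Qed.

Lemma perm_var (w : 'S_n) i : sb (fun i => x (w i)) (x i) = x (w i).
Proof. by rewrite sb_var // fcst_var. Qed.

Definition fps_symmetric p := forall w : 'S_n, sb (fun i => x (w i)) p = p.

Lemma act_var_den (w : 'S_n) i : sb (fun i => x (w i)) (var_den i) =
  var_den (w i).
Proof.
rewrite rmorph_prod [RHS](reindex_inj (@perm_inj _ w)) /=.
apply: eq_big => j; first by rewrite (inj_eq perm_inj).
by rewrite rmorphB /= !perm_var.
Qed.

Lemma sof_perm (w : 'S_n) M M' p :
  (forall i, sb (fun i => x (w i)) (M i) = M' (w i)) ->
  is_sum_of_fractions 1 M var_den p ->
  is_sum_of_fractions 1 M' var_den (sb (fun i => x (w i)) p).
Proof.
move=> hM hp; have bw : bijective w.
  by exists (w^-1)%g; [apply: permK | apply: permKV].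
apply: (sof_reindex bw); apply: eq_sof (sof_morph (sb (fun i => x (w i))) hp).
  by move=> i; rewrite /= hM.
by move=> i; rewrite /= act_var_den.
Qed.

(** The transposition (i j) maps M i to M j and is invisible on x_i = x_j, which is the Lagrange
    condition; uniqueness of the sum makes p symmetric. *)
Lemma lagrange_sum_sym M :
  (forall (w : 'S_n) i, sb (fun i => x (w i)) (M i) = M (w i)) ->
  exists2 p, is_sum_of_fractions 1 M var_den p & fps_symmetric p.
Proof.
move=> hM; have [|p hp] := @lagrange_sum M.
  by move=> i j ij; rewrite -(ev_tperm i j (M i)) hM tpermL.
exists p => // w; apply: (sof_unique lreg_var_den _ hp).
by apply: (sof_perm _ hp) => i; rewrite hM.
Qed.

End Lagrange.

(** * Adding a part *)

Lemma lift_perm_exists n (w : 'S_n.+1) (i : 'I_n.+1) :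
  exists s : 'S_n, forall k, w (lift i k) = lift (w i) (s k).
Proof.
have /fin_all_exists[s hs] k : exists k', w (lift i k) = lift (w i) k'.
  case: (unliftP (w i) (w (lift i k))) => [k' ->|/perm_inj e];
    first by exists k'.
  by have := neq_lift i k; rewrite e eqxx.
have si : injective s.
  move=> k k' e; apply: (@lift_inj _ i); apply: (@perm_inj _ w).
  by rewrite !hs e.
by exists (perm si) => k; rewrite hs permE.
Qed.

Section Step.
Variables (R : comNzRingType) (F : fps 'I_2 R) (chi : fps 'I_1 R).
Hypothesis hF : fgl_axioms F chi.
Variables C Q : fps 'I_2 R.
Hypothesis hCQ : forall (I : choiceType) (f g : fps I R),
  fcst f = 0 -> fcst g = 0 ->
  [/\ f - g = eval2 F f (fneg chi g) * eval2 C f g,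
      eval2 F f g * eval2 C f g - (f - g) = eval2 F g g * eval2 Q f g &
      eval2 Q f f = eval2 C f f].

Local Notation x i := (fX R i).
Local Notation ev i z := (sb (upd i z)).
Local Notation act w := (sb (fun i => x (w i))).
Local Notation var_den := (@var_den R _).

(* ratio_num x y / (x - y) = (x +_F y) / (x +_F \bar y). *)
Definition ratio_num (I : choiceType) (f g : fps I R) :=
  locked_with fps_key (eval2 F f g * eval2 C f g).

Lemma ratio_numE (I : choiceType) (f g : fps I R) : ratio_num f g =
  eval2 F f g * eval2 C f g.
Proof. by rewrite /ratio_num unlock. Qed.

Definition eval1 (g : fps 'I_1 R) (I : choiceType) (y : fps I R) :=
  sb (fun=> y) g.

Lemma sb_ratio_num (I : choiceType) n (h : 'I_n -> fps I R) f g :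
  sb h (ratio_num f g) = ratio_num (sb h f) (sb h g).
Proof. by rewrite !ratio_numE rmorphM /= !sb_eval2. Qed.

Lemma sb_eval1 (I : choiceType) n (h : 'I_n -> fps I R) g y :
  sb h (eval1 g y) = eval1 g (sb h y).
Proof. exact: sb_comp1. Qed.

Lemma fneg0 (I : choiceType) : fneg chi (0 : fps I R) = 0.
Proof.
by have := faddN hF (@fcst0 R I); rewrite (fadd0r hF) // (fcst_fneg hF).
Qed.

Lemma ratio_num0 (I : choiceType) (f : fps I R) : fcst f = 0 ->
  ratio_num f 0 = f.
Proof.
move=> f0; have [h _ _] := hCQ f0 (@fcst0 R I).
by rewrite ratio_numE -{1}fneg0 -h subr0.
Qed.

(** The ratios (f +_F t) / (f +_F \bar t) and (f +_F \bar t) / (f +_F t) are inverse to each other: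
    this is how the factors of x_k and x_l cancel. *)
Lemma ratio_num_neg (I : choiceType) (f t : fps I R) : fcst f = 0 ->
  fcst t = 0 ->
  ratio_num f t * ratio_num f (fneg chi t) = (f - t) * (f - fneg chi t).
Proof.
move=> f0 t0; have [-> _ _] := hCQ f0 t0.
have [-> _ _] := hCQ f0 (fcst_fneg hF t).
by rewrite (fnegK hF) // !ratio_numE; ring.
Qed.

(** Any two variables are allowed, since the induction removes an arbitrary one and renumbers the
    others. *)
Definition fgl_cancels n (p : fps 'I_n R) := forall k l, k != l ->
  sb (fun i => if i == l then fneg chi (x k) else x i) p =
  sb (fun i => if (i == k) || (i == l) then 0 else x i) p.

(** The equivariance of G is part of the data: it cannot be deduced from the symmetry of p when t
    +_F t is a zero divisor. *)
Definition fgl_plus n (p : fps 'I_n R) := exists2 G : 'I_n -> fps 'I_n R,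
  forall i, p - ev i 0 p = eval2 F (x i) (x i) * G i &
  forall (w : 'S_n) i, act w (G i) = G (w i).

Section Fixed.
Variables (n : nat) (p' : fps 'I_n R) (g : fps 'I_1 R).
Implicit Types i j k l : 'I_n.+1.

(** This produces p'_i: [lift i] numbers the variables other than x_i. *)
Definition skip_var i : fps 'I_n R ->
  fps 'I_n.+1 R := sb (fun k : 'I_n => x (lift i k)).

Lemma act_skip_var (w : 'S_n.+1) i : exists2 s : 'S_n,
  forall k : 'I_n, w (lift i k) = lift (w i) (s k) &
  forall f, act w (skip_var i f) = skip_var (w i) (act s f).
Proof.
have [s hs] := lift_perm_exists w i; exists s => // f.
rewrite /skip_var !sb_sb; apply: eq_sb => k.
by rewrite !perm_var hs sb_var ?fcst_var.
Qed.

Lemma act_skip_var_sym (w : 'S_n.+1) i : fps_symmetric p' ->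
  act w (skip_var i p') = skip_var (w i) p'.
Proof. by move=> hp; have [s _ ->] := act_skip_var w i; rewrite hp. Qed.

Lemma ev_skip_var i z f : fcst z = 0 -> ev i z (skip_var i f) = skip_var i f.
Proof.
move=> z0; rewrite /skip_var sb_sb; apply: eq_sb => k.
by rewrite ev_var // eq_sym (negPf (neq_lift _ _)).
Qed.

Definition schur_term i := eval1 g (x i) * \prod_(j | j != i) ratio_num (x i)
  (x j) * skip_var i p'.

Lemma act_schur_term (w : 'S_n.+1) i : fps_symmetric p' ->
  act w (schur_term i) = schur_term (w i).
Proof.
move=> hp; rewrite !rmorphM rmorph_prod /= sb_eval1 perm_var act_skip_var_sym
  //.
congr (_ * _ * _); rewrite [RHS](reindex_inj (@perm_inj _ w)) /=.
apply: eq_big => j; first by rewrite (inj_eq perm_inj).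
by rewrite sb_ratio_num !perm_var.
Qed.

(** * Cancellation at x_l = \bar x_k *)

Section Cancel.
Hypotheses (hs : fps_symmetric p') (hc : fgl_cancels p').
Variable p : fps 'I_n.+1 R.
Hypothesis hp : is_sum_of_fractions 1 schur_term var_den p.
Variables k l : 'I_n.+1.
Hypothesis kl : k != l.
Let lk : l != k. Proof. by rewrite eq_sym. Qed.
Let rho := (fun i => if i == l then fneg chi (x k) else x i).
Let rho0 := (fun i => if (i == k) || (i == l) then 0 else x i).

Let rho_x i : sb rho (x i) = if i == l then fneg chi (x k) else x i.
Proof. by rewrite sb_var // /rho; case: eqP => _;
  rewrite ?(fcst_fneg hF) ?fcst_var. Qed.

Let rho0_x i : sb rho0 (x i) = if (i == k) || (i == l) then 0 else x i.
Proof. by rewrite sb_var // /rho0; case: ifP => _;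
  rewrite ?fcst0 ?fcst_var. Qed.

Let others i := (i != k) && (i != l).
Let D i := \prod_(j | others j) (x i - x j).
(** The term i stripped of its factor x_i +_F x_j, for {i, j} = {k, l}. *)
Let m i j := eval1 g (x i) * eval2 C (x i) (x j) * (\prod_(t | others t)
  ratio_num (x i) (x t))
  * skip_var i p'.

Let indep_fneg j : j != k -> indep j (fneg chi (x k)).
Proof.
move=> jk; split=> [|z z0]; first exact: (fcst_fneg hF).
by rewrite sb_fneg ev_var // eq_sym (negPf jk).
Qed.

Let denk : var_den k = (x k - x l) * D k.
Proof. by rewrite /var_den (bigD1 l). Qed.

Let denl : var_den l = (x l - x k) * D l.
Proof.
rewrite /var_den (bigD1 k) //=; congr (_ * _).
by apply: eq_bigl => j; rewrite andbC.
Qed.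

(* The terms k and l have opposite poles along x_k = x_l; z / (D k * D l) is
   their sum divided by x_k +_F x_l. *)
Lemma cancel_merge : exists z,
  D k * D l * (\prod_(t | others t) var_den t) * p =
  eval2 F (x k) (x l) * z * (\prod_(t | others t) var_den t) +
  D k * D l * \sum_(t | others t) schur_term t *
     \prod_(s | [&& s != k, s != l & s != t]) var_den s.
Proof.
have Mk : schur_term k = eval2 F (x k) (x l) * m k l.
  by rewrite /schur_term (bigD1 l) //= /m ratio_numE; ring.
have Ml : schur_term l = eval2 F (x k) (x l) * m l k.
  rewrite /schur_term (bigD1 k) //= /m ratio_numE (faddC hF) ?fcst_var //.
  rewrite (eq_bigl others); first by ring.
  by move=> j; rewrite andbC.
(* The transposition (k l) turns y into m l k * D k, so the difference of the two numerators
   vanishes at x_k = x_l and has a quotient z by x_k - x_l. *)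
pose y := m k l * D l.
have ty : act (tperm k l) y = m l k * D k.
  have oth j : others (tperm k l j) = others j.
    by rewrite /others; case: tpermP => [->|->|]; rewrite ?eqxx ?andbF.
  rewrite !rmorphM !rmorph_prod /= sb_eval1 sb_eval2 !perm_var act_skip_var_sym
    // tpermL tpermR.
  rewrite /m /D [\prod_(t | others t) ratio_num (x l)
    _](reindex_inj (@perm_inj _ (tperm k l))).
  rewrite [\prod_(t | others t) (x k - _)](reindex_inj (@perm_inj _ (tperm k
    l))) /=.
  congr (_ * _ * _ * _); apply: eq_big => j; rewrite ?oth // => _.
    by rewrite sb_ratio_num !perm_var tpermL.
  by rewrite rmorphB /= !perm_var tpermR.
have [|z hz] := div_xB (@indep_var R n.+1 k l lk) (f := y - act (tperm k l) y).
  by rewrite rmorphB /= ev_tperm subrr.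
exists z; have := hp; rewrite /is_sum_of_fractions mul1r.
rewrite (prod_split2 _ kl) (sum_split2 _ _ kl) -/(others _).
set P := \prod_(t | _) var_den t; set S := \sum_(t | _) _ => h.
have rd : GRing.lreg (x k - x l) := lreg_subx kl.
(* One factor x_k - x_l comes from each of the denominators k and l; both are cancelled now, before
   the specialisation can spoil their regularity. *)
apply: (rd); apply: (rd).
transitivity (- (var_den k * var_den l * P * p)); first by rewrite denk denl;
  ring.
rewrite h denk denl Mk Ml.
transitivity ((x k - x l) * eval2 F (x k) (x l) * (m k l * D l - m l k * D k)
  * P
  + (x k - x l) * (x k - x l) * (D k * D l * S)); first by ring.
by rewrite -ty hz; ring.
Qed.

Let q i j := (j != i) && (j != k) && (j != l).
(** What is left of the fraction i at x_l = \bar x_k: neither [N2 i] nor [D2 i] involves x_k or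
    x_l. *)
Let N2 i := if others i then
  eval1 g (x i) * (\prod_(j | q i j) ratio_num (x i) (x j))
    * sb rho0 (skip_var i p') else 0.
Let D2 i := if others i then \prod_(j | q i j) (x i - x j) else 1.

Let lreg_D2 i : GRing.lreg (D2 i).
Proof.
rewrite /D2; case: ifP => _; last exact: GRing.lreg1.
by apply: lreg_prod => j /andP[/andP[ji _] _]; apply: lreg_subx; rewrite eq_sym.
Qed.

(** The induction hypothesis [hc], transported along [lift i]. *)
Let rho_skip_var i : others i -> sb rho (skip_var i p') =
  sb rho0 (skip_var i p').
Proof.
move=> /andP[ik il].
have [k1 ek] : exists k1 : 'I_n, k = lift i k1.
  by case: (unliftP i k) ik => [k1 -> _|->]; [exists k1 | rewrite eqxx].
have [l1 el] : exists l1 : 'I_n, l = lift i l1.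
  by case: (unliftP i l) il => [l1 -> _|->]; [exists l1 | rewrite eqxx].
have kl1 : k1 != l1 by apply: contraNneq kl => e; rewrite ek el e.
have sE (f : 'I_n.+1 -> fps 'I_n.+1 R) (h : 'I_n -> fps 'I_n R) :
    (forall t, sb f (x (lift i t)) = sb (fun t : 'I_n => x (lift i t)) (h t)) ->
    sb f (skip_var i p') = skip_var i (sb h p').
  by move=> ht; rewrite /skip_var !sb_sb; apply: eq_sb.
have lx (t : 'I_n) : sb (fun t : 'I_n => x (lift i t)) (x t) = x (lift i t).
  by rewrite sb_var // fcst_var.
rewrite (sE _ (fun t => if t == l1 then fneg chi (x k1) else x t)); last first.
  move=> t; rewrite rho_x el (inj_eq lift_inj).
  by case: eqP => _; rewrite ?sb_fneg lx // ek.
rewrite hc // (sE _ (fun t => if (t == k1) || (t == l1) then 0 else x t)) //.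
move=> t; rewrite rho0_x el ek !(inj_eq lift_inj).
by case: ifP => _; rewrite ?rmorph0 ?lx.
Qed.

(** In [cancel_merge] the merged term vanishes with x_k +_F \bar x_k, and D k * D l stays regular,
    being a product of factors x_k - x_j and \bar x_k - x_j. In the other terms [ratio_num_neg]
    removes the factors of x_k and x_l. *)
Let sof_rho : is_sum_of_fractions 1 N2 D2 (sb rho p).
Proof.
have [z /(congr1 (sb rho))] := cancel_merge.
set P := \prod_(t | _) _; set S := \sum_(t | _) _.
have F0 : sb rho (eval2 F (x k) (x l)) = 0.
  by rewrite sb_eval2 !rho_x eqxx (negPf kl) (faddN hF) ?fcst_var.
have rD : GRing.lreg (sb rho (D k * D l)).
  rewrite rmorphM !rmorph_prod; apply: GRing.lregM;
    apply: lreg_prod => j /andP[jk jl];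
    rewrite rmorphB /= !rho_x ?eqxx (negPf jl) ?(negPf kl).
    by apply: lreg_subx; rewrite eq_sym.
  by rewrite -opprB; apply/lregN/lreg_xB/indep_fneg.
rewrite !rmorphM rmorphD !rmorphM /= F0 !mul0r add0r -rmorphM /= -!mulrA =>
  e; have {e} := rD _ _ e.
rewrite !rmorph_prod rmorph_sum /= => h.
have {}h : \prod_(t | others t) sb rho (var_den t) * sb rho p =
  \sum_(t | others t) sb rho (schur_term t) *
     \prod_(s | [&& s != k, s != l & s != t]) sb rho (var_den s).
  by rewrite h; apply: eq_bigr => t _; rewrite rmorphM rmorph_prod.
have denE i : others i -> sb rho (var_den i) =
    (x i - x k) * (x i - fneg chi (x k)) * \prod_(j | q i j) (x i - x j).
  move=> /andP[ik il]; rewrite /var_den rmorph_prod (bigD1 k) 1?eq_sym //=.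
  rewrite (bigD1 l) /=; last by rewrite eq_sym il.
  rewrite !rmorphB /= !rho_x eqxx (negPf il) (negPf kl) mulrA; congr (_ * _).
  apply: eq_bigr => j /andP[_ /negPf jl].
  by rewrite rmorphB /= !rho_x (negPf il) jl.
apply: (sof_eq_frac _ _ (sof_drop2 kl h)) => i; rewrite -/(others i) /N2 /D2.
  case: ifP => [oi|_]; last exact: GRing.lreg1.
  rewrite denE //; have /andP[ik il] := oi.
  apply: GRing.lregM; first apply: GRing.lregM.
  - exact: lreg_subx.
  - exact/lreg_xB/indep_fneg.
  - by apply: lreg_prod => j /andP[/andP[ji _] _]; apply: lreg_subx;
    rewrite eq_sym.
case: ifP => [oi|_]; last by rewrite !mul0r.
have /andP[ik il] := oi; rewrite denE //
  /schur_term !rmorphM /= sb_eval1 rho_skip_var //.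
rewrite [\prod_(j | j != i) _](bigD1 k) 1?eq_sym //= (bigD1 l) /=; last first.
  by rewrite eq_sym il.
rewrite !rmorphM /= !sb_ratio_num !rho_x eqxx (negPf il) (negPf kl).
rewrite (mulrA (ratio_num _ _)) ratio_num_neg ?fcst_var //.
rewrite rmorph_prod (eq_bigr (fun j => ratio_num (x i) (x j))).
  by rewrite /q; ring.
by move=> j /andP[_ /negPf jl] /=; rewrite sb_ratio_num !rho_x (negPf il) jl.
Qed.

(** The fractions in [sof_rho] are free of x_k, so their sum is unchanged by x_k = 0, which turns
    \bar x_k into 0 as well. *)
Lemma step_cancel : sb rho p = sb rho0 p.
Proof.
have h := sof_morph (sb (upd k 0)) sof_rho.
have kx i : sb (upd k 0) (x i) = if i == k then 0 else x i.
  by rewrite ev_var ?fcst0.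
have E f : sb (upd k 0) (sb rho f) = sb rho0 f.
  rewrite sb_sb; apply: eq_sb => i; rewrite /rho /rho0.
  case: (i =P l) => [->|_]; last by rewrite orbF kx.
  by rewrite sb_fneg kx eqxx fneg0 orbT.
have E0 f : sb (upd k 0) (sb rho0 f) = sb rho0 f.
  rewrite sb_sb; apply: eq_sb => i; rewrite /rho0.
  by case: (i =P k) => [->|/eqP/negPf ik] /=; case: (i =P l) => _;
    rewrite ?rmorph0 // kx ik.
rewrite -E; apply: (sof_unique lreg_D2 sof_rho).
apply: eq_sof h => i.
  rewrite /N2; case: ifP => [oi|_]; last by rewrite rmorph0.
  have ik : i == k = false by case/andP: oi => /negPf.
  rewrite !rmorphM rmorph_prod /= sb_eval1 E0 kx ik; congr (_ * _ * _).
  by apply: eq_bigr => j /andP[/andP[_ /negPf jk] _];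
    rewrite sb_ratio_num !kx ik jk.
rewrite /D2; case: ifP => [oi|_]; last by rewrite rmorph1.
have ik : i == k = false by case/andP: oi => /negPf.
rewrite rmorph_prod; apply: eq_bigr => j /andP[/andP[_ /negPf jk] _].
by rewrite rmorphB /= !kx ik jk.
Qed.
End Cancel.

(** * Divisibility by t +_F t *)

Section Plus.
Hypothesis hs : fps_symmetric p'.
Variable gh : fps 'I_1 R.
Hypothesis hg : g = eval2 F (x (ord0 : 'I_1)) (x (ord0 : 'I_1)) * gh.
Variable G' : 'I_n -> fps 'I_n R.
Hypothesis hG1 : forall k : 'I_n, p' - ev k 0 p' = eval2 F (x k) (x k) * G' k.
Hypothesis hG2 : forall (w : 'S_n) (k : 'I_n), act w (G' k) = G' (w k).
Variable p : fps 'I_n.+1 R.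
Hypothesis hp : is_sum_of_fractions 1 schur_term var_den p.

Let eval1_double (y : fps 'I_n.+1 R) : fcst y = 0 ->
  eval1 g y = eval2 F y y * eval1 gh y.
Proof. by move=> y0; rewrite /eval1 hg rmorphM /= sb_eval2 sb_var. Qed.

Let eval1_0 : eval1 g (0 : fps 'I_n.+1 R) = 0.
Proof. by rewrite eval1_double ?fcst0 // (fadd0 hF) ?fcst0 // mul0r. Qed.

Let ev0_x l i : ev l 0 (x i) = if i == l then 0 else x i.
Proof. by rewrite ev_var ?fcst0. Qed.

(** The quotient of p'_i - p'_i(x_l = 0) by x_l +_F x_l supplied by the induction hypothesis; the
    value 0 at l = i is a default. *)
Definition lift_quot i l := if unlift i l is Some k then skip_var i (G' k)
  else 0.

Let lift_quot_lift i (k : 'I_n) : lift_quot i (lift i k) = skip_var i (G' k).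
Proof. by rewrite /lift_quot liftK. Qed.

Let act_lift_quot (w : 'S_n.+1) i l : act w (lift_quot i l) =
  lift_quot (w i) (w l).
Proof.
case: (unliftP i l) => [k|] ->; last by rewrite /lift_quot !unlift_none rmorph0.
by rewrite lift_quot_lift; have [s sE ->] := act_skip_var w i;
  rewrite sE lift_quot_lift hG2.
Qed.

Let ev_lift_quot i l z : fcst z = 0 -> ev i z (lift_quot i l) = lift_quot i l.
Proof. by rewrite /lift_quot => z0; case: unlift => [k|];
  rewrite ?rmorph0 ?ev_skip_var. Qed.

Let skip_var_ev i (k : 'I_n) : ev (lift i k) 0 (skip_var i p') =
  skip_var i (ev k 0 p').
Proof.
rewrite /skip_var !sb_sb; apply: eq_sb => t;
  rewrite ev0_x /upd (inj_eq lift_inj).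
by case: eqP => _; rewrite ?rmorph0 // sb_var ?fcst_var.
Qed.

Let lift_quotE i l : l != i -> skip_var i p' - ev l 0 (skip_var i p') =
  eval2 F (x l) (x l) * lift_quot i l.
Proof.
case: (unliftP i l) => [k|] ->; last by rewrite eqxx.
rewrite skip_var_ev lift_quot_lift -rmorphB hG1 rmorphM /= sb_eval2.
by rewrite sb_var ?fcst_var.
Qed.

(** The ratio of x_i against x_l is 1 at x_l = 0, so over x_i - x_l its value there has numerator
    x_i - x_l. The product rule then splits the difference into a part divided by means of
    [lift_quot] and a part divided by means of Q. *)
Definition plus_factor i l := ratio_num (x i) (x l)
  * lift_quot i l + eval2 Q (x i) (x l) * ev l 0 (skip_var i p').

Let plus_factorE i l : l != i ->
  ratio_num (x i) (x l) * skip_var i p' - (x i - x l) * ev l 0 (skip_var i p') =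
  eval2 F (x l) (x l) * plus_factor i l.
Proof.
move=> li; have [_ h _] := hCQ (@fcst_var _ R i) (@fcst_var _ R l).
transitivity (ratio_num (x i) (x l) * (skip_var i p' - ev l 0 (skip_var i p'))
  + (ratio_num (x i) (x l) - (x i - x l)) * ev l 0 (skip_var i p'));
    first by ring.
by rewrite lift_quotE // ratio_numE h /plus_factor ratio_numE; ring.
Qed.

(* The quotient of p - p(x_l = 0) by x_l +_F x_l is
   \sum_i plus_term l i / var_den i. *)
Definition plus_term l i :=
  if i == l then eval1 gh (x l) * (\prod_(j | j != l) ratio_num (x l) (x j))
    * skip_var l p'
  else eval1 g (x i) * (\prod_(j | (j != i) && (j != l)) ratio_num (x i)
    (x j)) * plus_factor i l.

Let act_ev (w : 'S_n.+1) l f : act w (ev l 0 f) = ev (w l) 0 (act w f).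
Proof.
rewrite !sb_sb; apply: eq_sb => i; rewrite /upd ev0_x (inj_eq perm_inj).
by case: eqP => _; rewrite ?rmorph0 ?perm_var.
Qed.

Let act_plus_term (w : 'S_n.+1) l i : act w (plus_term l i) =
  plus_term (w l) (w i).
Proof.
rewrite /plus_term (inj_eq perm_inj); case: eqP => [_|_].
  rewrite !rmorphM rmorph_prod /= sb_eval1 perm_var act_skip_var_sym //;
    congr (_ * _ * _).
  rewrite [RHS](reindex_inj (@perm_inj _ w)) /=.
  apply: eq_big => j; first by rewrite (inj_eq perm_inj).
  by rewrite sb_ratio_num !perm_var.
rewrite !rmorphM rmorph_prod /= sb_eval1 perm_var; congr (_ * _ * _).
  rewrite [RHS](reindex_inj (@perm_inj _ w)) /=.
  apply: eq_big => j; first by rewrite !(inj_eq perm_inj).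
  by rewrite sb_ratio_num !perm_var.
by rewrite /plus_factor rmorphD !rmorphM /= sb_ratio_num sb_eval2 act_lift_quot
  act_ev act_skip_var_sym // !perm_var.
Qed.

(** At x_i = x_l the identity Q(x, x) = C(x, x) turns [plus_factor i l] into C(x_l, x_l) p'_i. On
    the other side the ratio against x_i contributes (x_l +_F x_l) C(x_l, x_l), whose first factor
    turns gh into g. *)
Let plus_term_last l i : i != l ->
  ev i (x l) (plus_term l i) = ev i (x l) (plus_term l l).
Proof.
move=> il; have li : l != i by rewrite eq_sym.
rewrite /plus_term (negPf il) eqxx.
rewrite !rmorphM !rmorph_prod /= !sb_eval1 !ev_x eqxx (negPf li).
rewrite [in RHS](bigD1 i) //=.
have e0 : ev i (x l) (ev l 0 (skip_var i p')) = ev l 0 (skip_var i p').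
  rewrite /skip_var (sb_sb (upd l 0)) sb_sb; apply: eq_sb => t; rewrite ev0_x.
  case: eqP => _; rewrite ?rmorph0 // ev_x.
  by rewrite eq_sym (negPf (neq_lift _ _)).
have -> : ev i (x l) (plus_factor i l) = eval2 C (x l) (x l) * skip_var i p'.
  rewrite /plus_factor rmorphD !rmorphM /= sb_ratio_num sb_eval2 ev_lift_quot
    ?fcst_var // e0 !ev_x eqxx (negPf li).
  have [_ _ ->] := hCQ (@fcst_var _ R l) (@fcst_var _ R l).
  transitivity (eval2 C (x l) (x l) * (eval2 F (x l) (x l)
    * lift_quot i l + ev l 0 (skip_var i p'))).
    by rewrite ratio_numE; ring.
  by rewrite -lift_quotE // subrK.
have -> : ev i (x l) (skip_var l p') = skip_var i p'.
  by rewrite -ev_tperm act_skip_var_sym // tpermR ev_skip_var ?fcst_var.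
rewrite eval1_double ?fcst_var // sb_ratio_num !ev_x eqxx (negPf li) ratio_numE.
pose P := \prod_(j | (j != i) && (j != l)) ratio_num (x l) (x j).
have PE t (q : pred 'I_n.+1) : t \in [:: i; l] ->
    q =1 (fun j => (j != i) && (j != l)) ->
    \prod_(j | q j) ev i (x l) (ratio_num (x t) (x j)) = P.
  move=> tE qE; apply: eq_big => // j; rewrite qE => /andP[/negPf ji _].
  rewrite sb_ratio_num !ev_x ji; move: tE; rewrite !inE => /orP[] /eqP->.
    by rewrite eqxx.
  by rewrite (negPf li).
rewrite !PE ?inE ?eqxx ?orbT // => [|j]; first by ring.
by rewrite andbC.
Qed.

(** For i and j different from l the transposition (i j) fixes l, so the Lagrange condition follows
    from the equivariance of the terms, hence of G'; pairs containing l are [plus_term_last].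
    Uniqueness of the sums makes the new family equivariant. *)
Lemma step_plus_quot : exists2 G : 'I_n.+1 -> fps 'I_n.+1 R,
  forall l, is_sum_of_fractions 1 (plus_term l) var_den (G l) &
  forall (w : 'S_n.+1) l, act w (G l) = G (w l).
Proof.
have /fin_all_exists[G hG] l : exists f,
  is_sum_of_fractions 1 (plus_term l) var_den f.
  apply: lagrange_sum => i j ij.
  have [il|il] := eqVneq i l.
    by rewrite il; apply/ev_eq_switch/esym/plus_term_last; rewrite -il eq_sym.
  have [jl|jl] := eqVneq j l; first by rewrite jl; apply: plus_term_last.
  by rewrite -(ev_tperm i j (plus_term l i)) act_plus_term tpermL tpermD //
    eq_sym.
exists G => // w l; apply: (sof_unique (@lreg_var_den _ _) _ (hG (w l))).
exact: (sof_perm (fun i => act_plus_term w l i) (hG l)).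
Qed.

Lemma step_plus : fgl_plus p.
Proof.
have [G hG1' hG2'] := step_plus_quot; exists G => // l.
apply: (sof_unique (@lreg_var_den _ _) _ (sofZ (eval2 F (x l) (x l)) (hG1' l))).
pose K i := eval1 g (x i) * \prod_(j | (j != i) && (j != l)) ratio_num (x i)
  (x j).
(* The numerators of p(x_l = 0), brought back to the denominators [var_den]: the term l vanishes
   with g(0), and in the others the ratio against x_l has become 1. *)
pose M0 i := if i == l then 0 else K i * (x i - x l) * ev l 0 (skip_var i p').
have hM0 : is_sum_of_fractions 1 M0 var_den (ev l 0 p).
  apply: (sof_eq_frac _ _ (sof_morph (sb (upd l 0)) hp)) => i.
    rewrite rmorph_prod; apply: lreg_prod => j ji; rewrite rmorphB /= !ev0_x.
    case: (i =P l) => [il|_]; case: (j =P l) => [jl|_].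
    - by rewrite il jl eqxx in ji.
    - by rewrite sub0r; apply/lregN/lreg_var.
    - by rewrite subr0; apply: lreg_var.
    - by apply: lreg_subx; rewrite eq_sym.
  rewrite /M0 /schur_term; case: (i =P l) => [->|/eqP il].
    by rewrite !rmorphM /= sb_eval1 ev0_x eqxx eval1_0 !mul0r.
  have li : l != i by rewrite eq_sym.
  rewrite !rmorphM /= sb_eval1 (bigD1 l)
    //= rmorphM /= sb_ratio_num !ev0_x eqxx (negPf il).
  have denE : var_den i = (x i - x l) * \prod_(j | (j != i) && (j != l))
    (x i - x j).
    by rewrite /var_den (bigD1 l).
  rewrite ratio_num0 ?fcst_var // denE.
  rewrite rmorphM rmorphB /= !ev0_x eqxx (negPf il) subr0 !rmorph_prod.
  have E1 : \prod_(j | (j != i) && (j != l)) ev l 0 (ratio_num (x i) (x j)) =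
      \prod_(j | (j != i) && (j != l)) ratio_num (x i) (x j).
    by apply: eq_bigr => j /andP[_ /negPf jl];
      rewrite sb_ratio_num !ev0_x jl (negPf il).
  have E2 : \prod_(j | (j != i) && (j != l)) ev l 0 (x i - x j) =
      \prod_(j | (j != i) && (j != l)) (x i - x j).
    by apply: eq_bigr => j /andP[_ /negPf jl];
      rewrite rmorphB /= !ev0_x jl (negPf il).
  rewrite /= E1 E2.
  by rewrite /K; ring.
apply: eq_sof (sofB hp hM0) => // i; rewrite /M0 /plus_term /schur_term.
case: (i =P l) => [->|/eqP il];
  first by rewrite subr0 eval1_double ?fcst_var //; ring.
have li : l != i by rewrite eq_sym.
rewrite (bigD1 l) //=.
transitivity (K i * (ratio_num (x i) (x l) * skip_var i p' - (x i - x l)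
  * ev l 0 (skip_var i p'))).
  by rewrite /K; ring.
by rewrite plus_factorE // /K; ring.
Qed.

End Plus.
End Fixed.
End Step.

(** * Sums over the symmetric group *)

Lemma prod_lift (A : comNzRingType) n (i : 'I_n.+1) (f : 'I_n.+1 -> A) :
  \prod_(j | j != i) f j = \prod_(k < n) f (lift i k).
Proof.
rewrite (reindex_omap (lift i) (unlift i)) /=.
  by apply: eq_bigl => k; rewrite liftK eqxx eq_sym neq_lift.
by move=> j; case: (unliftP i j) => [k -> | ->]; rewrite ?eqxx.
Qed.

Definition pair_prod (T : Type) (A : comNzRingType) (h : T -> T -> A) n r
    (y : 'I_n -> T) : A :=
  \prod_(i < n | (i < r)%N) \prod_(j < n | (i < j)%N) h (y i) (y j).

Lemma pair_prodS (T : Type) (A : comNzRingType) (h : T -> T -> A) n r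
    (y : 'I_n.+1 -> T) :
  pair_prod h r.+1 y = (\prod_(k < n) h (y ord0) (y (lift ord0 k)))
    * pair_prod h r (fun k => y (lift ord0 k)).
Proof.
rewrite /pair_prod big_mkcond big_ord_recl /=; congr (_ * _).
  by rewrite big_mkcond big_ord_recl /= mul1r.
rewrite [RHS]big_mkcond; apply: eq_bigr => k _.
rewrite /bump /= add1n ltnS; case: ifP => // _.
by rewrite big_mkcond big_ord_recl /= mul1r -big_mkcond.
Qed.

Lemma pair_prod_morph (T T' : Type) (A B : comNzRingType) (phi :
  {rmorphism A -> B})
    (psi : T -> T') (h : T -> T -> A) (h' : T' -> T' -> B) n r (y : 'I_n -> T) :
  (forall u v, phi (h u v) = h' (psi u) (psi v)) ->
  phi (pair_prod h r y) = pair_prod h' r (fun i => psi (y i)).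
Proof.
move=> hh; rewrite rmorph_prod; apply: eq_bigr => i _.
by rewrite rmorph_prod; apply: eq_bigr => j _.
Qed.

Section SchurSums.
Variables (R : comNzRingType) (F : fps 'I_2 R) (chi : fps 'I_1 R).
Hypothesis hF : fgl_axioms F chi.
Local Notation x i := (fX R i).

Definition eval1_prod (gs : seq (fps 'I_1 R)) (I : choiceType) n (y :
  'I_n -> fps I R) :=
  \prod_(i < n | (i < size gs)%N) eval1 (nth 0 gs i) (y i).

Lemma eval1_prodS g gs (I : choiceType) n (y : 'I_n.+1 -> fps I R) :
  eval1_prod (g :: gs) y = eval1 g (y ord0) * eval1_prod gs (fun k =>
    y (lift ord0 k)).
Proof.
rewrite /eval1_prod big_mkcond big_ord_recl /=; congr (_ * _).
by rewrite [RHS]big_mkcond.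
Qed.

Definition schur_num gs (I : choiceType) n (y : 'I_n -> fps I R) :=
  eval1_prod gs y * pair_prod (@eval2 _ F I) (size gs) y.

Definition schur_den r (I : choiceType) n (y : 'I_n -> fps I R) :=
  pair_prod (fun u v : fps I R => eval2 F u (fneg chi v)) r y.

Lemma sb_schur_num gs (I : choiceType) n k (h : 'I_k ->
  fps I R) (y : 'I_n -> fps 'I_k R) :
  sb h (schur_num gs y) = schur_num gs (fun i => sb h (y i)).
Proof.
rewrite rmorphM rmorph_prod; congr (_ * _).
  by apply: eq_bigr => i _; rewrite /= sb_eval1.
by apply: pair_prod_morph => u v; apply: sb_eval2.
Qed.

Lemma sb_schur_den r (I : choiceType) n k (h : 'I_k -> fps I R) (y : 'I_n ->
  fps 'I_k R) :
  sb h (schur_den r y) = schur_den r (fun i => sb h (y i)).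
Proof. by apply: pair_prod_morph => u v; rewrite /= sb_eval2 sb_fneg. Qed.

(** It is a factor of the regular element x_i - x_j. *)
Lemma lreg_fsub n (i j : 'I_n) : i != j ->
  GRing.lreg (eval2 F (x i) (fneg chi (x j))).
Proof.
move=> ij; have [C [Q hCQ]] := fgl_quotients hF.
have [e _ _] := hCQ _ _ _ (@fcst_var _ R i) (@fcst_var _ R j).
by apply: (@lreg_mull _ _ (eval2 C (x i) (x j))); rewrite -e; apply: lreg_subx.
Qed.

Lemma lift_perm_bij n : bijective (fun t : 'I_n.+1 * 'S_n =>
  lift_perm ord0 t.1 t.2).
Proof.
apply: inj_card_bij; last by rewrite card_prod card_ord !card_Sn factS.
move=> [i u] [j v] /= e.
have ij : i = j by rewrite -(lift_perm_id ord0 i u) e lift_perm_id.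
move: e; rewrite -ij => e; congr pair; apply/permP => k.
by apply: (@lift_inj _ i); rewrite -!(lift_perm_lift ord0) e.
Qed.

(* lift_perm ord0 i u chooses the variable x_i for the first part and orders the
   remaining ones by u. *)
Theorem schur_sum_exists gs n : (size gs <= n)%N ->
  exists p : fps 'I_n R,
  [/\ is_sum_of_fractions (n - size gs)`!
        (fun w : 'S_n => schur_num gs (fun i => x (w i)))
        (fun w : 'S_n => schur_den (size gs) (fun i => x (w i))) p,
      fps_symmetric p, fgl_cancels chi p &
      (forall g, g \in gs -> exists gh,
         g = eval2 F (x (ord0 : 'I_1)) (x (ord0 : 'I_1)) * gh) -> fgl_plus F p].
Proof.
have [C [Q hCQ]] := fgl_quotients hF.
elim: gs n => [|g gs IH] n hn.
  (* With no parts every summand is 1 and the sum over S_n is n!, which is exactly the prefactor. *)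
  exists 1; split.
  - have n1 w : schur_num [::] (fun i => x ((w : 'S_n) i)) = 1.
      by rewrite /schur_num /eval1_prod /pair_prod !big_pred0 // mul1r.
    have d1 w : schur_den 0 (fun i => x ((w : 'S_n) i)) = 1.
      by rewrite /schur_den /pair_prod big_pred0.
    apply: (sof_common (C := 1) (K := fun=> 1)); first exact: GRing.lreg1.
      by move=> w; rewrite d1 mulr1.
    rewrite !mulr1 (eq_bigr (fun=> 1)) => [|w _]; last by rewrite n1 mulr1.
    by rewrite sumr_const card_Sn subn0.
  - by move=> w; rewrite rmorph1.
  - by move=> k l _; rewrite !rmorph1.
  - move=> _; exists (fun=> 0) => [i|w i]; last by rewrite rmorph0.
    by rewrite rmorph1 subrr mulr0.
case: n hn => // n hn; have [p' [hp' hs hc hpl]] := IH n hn.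
have [p hp sp] := lagrange_sum_sym (fun w i =>
  @act_schur_term R F C n p' g w i hs).
exists p; split=> //; last 2 first.
- by move=> k l kl; apply: (step_cancel hF hCQ hs hc hp kl).
- move=> hg; have [|G' hG1 hG2] := hpl.
    by move=> g' g'in; apply: hg; rewrite inE g'in orbT.
  have [gh hgh] := hg g (mem_head _ _).
  exact: (step_plus hF hCQ hs hgh hG1 hG2 hp).
pose K (i : 'I_n.+1) := eval1 g (x i) * \prod_(j | j != i) eval2 F (x i) (x j).
pose D (i : 'I_n.+1) := \prod_(j | j != i) eval2 F (x i) (fneg chi (x j)) :
  fps 'I_n.+1 R.
have rD i : GRing.lreg (D i).
  by apply: lreg_prod => j ji; apply: lreg_fsub; rewrite eq_sym.
(* The series C converts the denominators x_i - x_j back to x_i +_F \bar x_j. *)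
have hp1 : is_sum_of_fractions 1 (fun i => K i * skip_var i p') D p.
  apply: (sof_eq_frac (@lreg_var_den _ _) _ hp) => i.
  rewrite /schur_term /K /var_den /D.
  transitivity (eval1 g (x i) * skip_var i p' *
    \prod_(j | j != i) (ratio_num F C (x i) (x j) * eval2 F (x i)
      (fneg chi (x j)))).
    by rewrite big_split /=; ring.
  transitivity (eval1 g (x i) * skip_var i p' *
    \prod_(j | j != i) (eval2 F (x i) (x j) * (x i - x j))).
    congr (_ * _); apply: eq_bigr => j _; rewrite ratio_numE.
    by have [-> _ _] := hCQ _ _ _ (@fcst_var _ R i) (@fcst_var _ R j); ring.
  by rewrite big_split /=; ring.
(* The prefactor of p' carries over: n + 1 variables and one more part leave the difference n - size
   gs unchanged. *)
have hp2 (i : 'I_n.+1) := sof_morph (sb (fun k : 'I_n => x (lift i k))) hp'.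
have := sof_nested rD _ hp1 hp2.
have lx (i : 'I_n.+1) (k : 'I_n) : sb (fun k : 'I_n => x (lift i k)) (x k) =
  x (lift i k).
  by rewrite sb_var // fcst_var.
have dE (i : 'I_n.+1) (u : 'S_n) : sb (fun k : 'I_n => x (lift i k))
    (schur_den (size gs) (fun i => x (u i))) =
      schur_den (size gs) (fun k => x (lift i (u k))).
  by rewrite sb_schur_den; congr schur_den; apply: funext => k; rewrite lx.
have nE (i : 'I_n.+1) (u : 'S_n) : sb (fun k : 'I_n => x (lift i k))
    (schur_num gs (fun i => x (u i))) =
      schur_num gs (fun k => x (lift i (u k))).
  by rewrite sb_schur_num; congr schur_num; apply: funext => k; rewrite lx.
have lE (i : 'I_n.+1) (u : 'S_n) (k : 'I_n) :
  x (lift_perm ord0 i u (lift ord0 k)) =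
    x (lift i (u k)) by rewrite lift_perm_lift.
have prodE (h : fps 'I_n.+1 R -> fps 'I_n.+1 R ->
  fps 'I_n.+1 R) (i : 'I_n.+1) (u : 'S_n) :
    \prod_(j | j != i) h (x i) (x j) =
    \prod_(k < n) h (x (lift_perm ord0 i u ord0))
      (x (lift_perm ord0 i u (lift ord0 k))).
  rewrite prod_lift (reindex_inj (@perm_inj _ u)) /=.
  by apply: eq_bigr => k _; rewrite lE lift_perm_id.
move=> h; apply: (sof_reindex (lift_perm_bij n)); apply: eq_sof (h _).
- move=> [i u]; rewrite /= nE /K (prodE _ _ u)
  /schur_num eval1_prodS pair_prodS lift_perm_id.
  have -> : (fun k => x (lift_perm ord0 i u (lift ord0 k))) =
    (fun k => x (lift i (u k))).
    by apply: funext => k; rewrite lE.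
  by ring.
- move=> [i u]; rewrite /= dE /D (prodE (fun a b =>
  eval2 F a (fneg chi b)) _ u) /schur_den.
  rewrite pair_prodS; congr (_ * pair_prod _ _ _).
  by apply: funext => k; rewrite lE.
- move=> i u; rewrite /= dE; apply: lreg_prod => a _; apply: lreg_prod => b ab.
  apply: lreg_fsub; rewrite (inj_eq lift_inj) (inj_eq perm_inj).
  by rewrite -(inj_eq val_inj) ltn_eqF.
Qed.

End SchurSums.

(** * The parameters as coefficients *)

Section MapSeries.
Variables (I : choiceType) (R S : comNzRingType) (phi : {rmorphism R -> S}).

Lemma fps_map_is_nmod_morphism : nmod_morphism (@fps_map I R S phi).
Proof.
split=> [|f g]; apply: fpsP => m;
  first by rewrite -[LHS]/(phi (fcoef 0 m)) !fcoef0 rmorph0.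
exact: rmorphD.
Qed.

Lemma fps_map_is_monoid_morphism : monoid_morphism (@fps_map I R S phi).
Proof.
split=> [|f g]; apply: fpsP => m.
  by rewrite -[LHS]/(phi (fcoef 1 m)) !fcoef1 rmorph_nat.
rewrite fcoefM; transitivity (phi (fcoef (f * g) m)); first exact: erefl.
by rewrite fcoefM rmorph_sum; apply: eq_bigr => k _; rewrite rmorphM.
Qed.

HB.instance Definition _ := GRing.isNmodMorphism.Build (fps I R) (fps I S)
  (@fps_map I R S phi) fps_map_is_nmod_morphism.
HB.instance Definition _ := GRing.isMonoidMorphism.Build (fps I R) (fps I S)
  (@fps_map I R S phi) fps_map_is_monoid_morphism.

Lemma fcoef_map (f : fps I R) m : fcoef (fps_map phi f) m = phi (fcoef f m).
Proof. by []. Qed.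

Lemma fps_map_const c : fps_map phi (fps_const I c) = fps_const I (phi c).
Proof. by apply: fpsP => m; rewrite fcoef_map !fcoefC raddfMn. Qed.

Lemma ford_map N (f : fps I R) : ford N f -> ford N (fps_map phi f).
Proof. by move=> h m mN; rewrite fcoef_map h ?rmorph0. Qed.

Lemma fps_map_X (i : I) : fps_map phi (fX R i) = fX S i.
Proof.
by apply: fpsP => m; rewrite fcoef_map !fvarE !fcoef_mon rmorph_nat.
Qed.

Lemma fcst_map (f : fps I R) : fcst (fps_map phi f) = phi (fcst f).
Proof. by []. Qed.

End MapSeries.

Lemma map_sb (R S : comNzRingType) (phi : {rmorphism R -> S}) (I : choiceType) n
    (g : 'I_n -> fps I R) f : (forall i, fcst (g i) = 0) ->
  fps_map phi (sb g f) = sb (fun i => fps_map phi (g i)) (fps_map phi f).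
Proof.
move=> hg; rewrite -!sbE //; last by move=> i; rewrite fcst_map hg rmorph0.
rewrite -[f in LHS]fps_map_id.
apply: (morph_subst (i0 := id) (i1 := phi)) => [c|N h|i].
- exact: fps_map_const.
- exact: ford_map.
- exact/ford1P/hg.
Qed.

Section Rename.
Variables (R : comNzRingType) (n : nat) (I : choiceType) (iota : 'I_n -> I).

Definition pushm (a : {cmonom 'I_n}) : {cmonom I} :=
  \big[mmul/mone]_(i < n) iter (a i) (mmul (ucm (iota i))) mone.

Lemma pushmE a j : pushm a j = (\sum_(i < n) a i * (iota i == j))%N.
Proof.
rewrite /pushm (big_morph (fun m : {cmonom I} => m j) (cmM j) (cm1 j)).
apply: eq_bigr => i _; elim: (a i) => [|k IH]; first by rewrite cm1.
by rewrite iterS cmM IH cmU mulSn.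
Qed.

Lemma mdeg_pushm a : mdeg (pushm a) = mdeg a.
Proof.
rewrite mdeg_ordE mdeg_prod; apply: eq_bigr => i _.
by elim: (a i) => [|k IH]; rewrite ?mdeg1 // iterS mdegM IH mdegU.
Qed.

Lemma gpow_rename a : gpow (fun i => fX R (iota i)) a = fmon (pushm a).
Proof.
rewrite /pushm (big_morph fmon (fun x y => fmonM R x y) (fmon1 _ _)).
apply: eq_bigr => i _; elim: (a i) => [|k IH]; first by rewrite expr0 fmon1.
by rewrite exprS IH fvarE -fmonM.
Qed.

(** Brings the axioms, stated in variables indexed by nat, down to two variables or one. *)
Lemma sb_rename_inj : injective iota ->
  injective (sb (fun i => fX R (iota i)) : fps 'I_n R -> fps I R).
Proof.
move=> ii f g e; apply: fpsP => a.
have pinj b : pushm b = pushm a -> b = a.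
  move=> /(congr1 (fun m : {cmonom I} => m)) pe; apply/eqP/cmP => i.
  have E c : pushm c (iota i) = c i.
    rewrite pushmE (bigD1 i) //= eqxx muln1 big1 ?addn0 // => j ji.
    by rewrite (inj_eq ii) (negPf ji) muln0.
  by rewrite -(E b) pe E.
have C h : fcoef (sb (fun i => fX R (iota i)) h) (pushm a) = fcoef h a.
  rewrite -sbE => [|i]; last exact: fcst_var.
  rewrite (fps_substE (s := [:: a])) //.
  - by rewrite big_seq1 gpow_rename fcoef_mon eqxx mulr1.
  - by move=> i; apply: ford_var.
  - move=> b; rewrite gpow_rename fcoef_mon inE.
    by case: (pushm a =P pushm b) => [/esym/pinj -> //|_]; rewrite mulr0 eqxx.
by rewrite -C e C.
Qed.
End Rename.

Section SeriesLaws.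
Variables (L : comNzRingType) (F : fps 'I_2 L) (chi : fps 'I_1 L).

Lemma fgl_addE (I : choiceType) (f g : fps I L) : fcst f = 0 -> fcst g = 0 ->
  fgl_add F f g = eval2 F f g.
Proof. by move=> f0 g0; rewrite /fgl_add sbE // => i; apply: fcst_pair_fun. Qed.

Lemma fgl_oppE (I : choiceType) (f : fps I L) : fcst f = 0 ->
  fgl_opp chi f = fneg chi f.
Proof. by move=> f0; rewrite /fgl_opp sbE. Qed.

Lemma is_fgl_axioms : is_fgl F -> is_fgl_inverse F chi -> fgl_axioms F chi.
Proof.
move=> [h1 _ h3 _] [h4 h5]; move: h1 h3 h5; rewrite !fXE.
rewrite !fgl_addE ?fcst0 ?fcst_var // => h1 h3 h5; split=> //.
- apply: (@sb_rename_inj L 2 nat val val_inj).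
  rewrite sb_eval2 !sb_var ?fcst_var // -[LHS]h3 /eval2.
  by apply: eq_sb => i; rewrite /pair_fun; case: i => [[|[|]]].
- apply: (@sb_rename_inj L 1 nat val val_inj).
  by rewrite sb_eval2 rmorph0 !sb_var ?fcst_var.
Qed.

Lemma fgl_axioms_map (S : comNzRingType) (phi : {rmorphism L -> S}) :
  fgl_axioms F chi -> fgl_axioms (fps_map phi F) (fps_map phi chi).
Proof.
move=> [h1 h2 h3 h4].
have E (I : choiceType) (f g : fps I L) : fcst f = 0 -> fcst g = 0 ->
    eval2 (fps_map phi F) (fps_map phi f) (fps_map phi g) =
      fps_map phi (eval2 F f g).
  move=> f0 g0; rewrite [RHS]map_sb => [|i]; last exact: fcst_pair_fun.
  by apply: eq_sb => i; rewrite /pair_fun; case: eqP.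
have x0 (I : choiceType) (i : I) := @fcst_var I L i.
split.
- by rewrite -[in RHS]h1 -!(fps_map_X phi) E.
- by rewrite -[RHS](fps_map_X phi) -h2 -!(fps_map_X phi)
  -(rmorph0 (fps_map phi)) E ?fcst0.
- by rewrite fcst_map h3 rmorph0.
- by rewrite -!(fps_map_X phi) E // h4 rmorph0.
Qed.
End SeriesLaws.

Section Unroll.
Variables (L : comNzRingType) (n : nat).
Local Notation J := ('I_n + nat)%type.
Local Notation S := (fps nat L).
Implicit Types (m : {cmonom J}) (a : {cmonom 'I_n}) (e : {cmonom nat}).

Definition resl m : {cmonom 'I_n} :=
  [cmonom m (inl i) | i in [fset i : 'I_n | true]]%M.

Definition resr m : {cmonom nat} := [cmonom m (inr j)
  | j in [fset j in pmap (fun s : J =>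
    if s is inr j then Some j else None) (finsupp m)]]%M.

Lemma reslE m i : resl m i = m (inl i).
Proof. by rewrite cmE fsfun_fun !inE. Qed.

Lemma resrE m j : resr m j = m (inr j).
Proof.
rewrite cmE fsfun_fun; case: ifP => //; rewrite !inE mem_pmap => h.
apply/esym/eqP; rewrite cmE_eq0; apply: contraFN h => h.
by apply/mapP; exists (inr j).
Qed.

Lemma monom_joinE a e (s : J) :
  monom_join a e s = match s with inl i => a i | inr j => e j end.
Proof.
rewrite cmE fsfun_fun; case: ifP => //; rewrite in_fsetU.
case: s => [i|j] h; apply/esym/eqP; rewrite cmE_eq0; apply: contraFN h => h.
  by rewrite (in_imfset _ (@inl _ _ : 'I_n -> J)).
by rewrite (in_imfset _ (@inr _ _ : nat -> J)) ?orbT.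
Qed.

Lemma resl_join a e : resl (monom_join a e) = a.
Proof. by apply/eqP/cmP => i; rewrite reslE monom_joinE. Qed.

Lemma resr_join a e : resr (monom_join a e) = e.
Proof. by apply/eqP/cmP => i; rewrite resrE monom_joinE. Qed.

Lemma join_res m : monom_join (resl m) (resr m) = m.
Proof. by apply/eqP/cmP => -[i|j]; rewrite monom_joinE ?reslE ?resrE. Qed.

Lemma resl_mul m m' : resl (mmul m m') = mmul (resl m) (resl m').
Proof. by apply/eqP/cmP => i; rewrite cmM !reslE cmM. Qed.

Lemma resr_mul m m' : resr (mmul m m') = mmul (resr m) (resr m').
Proof. by apply/eqP/cmP => i; rewrite cmM !resrE cmM. Qed.

Lemma join_mul a e a' e' : monom_join (mmul a a') (mmul e e') =
  mmul (monom_join a e) (monom_join a' e').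
Proof. by apply/eqP/cmP => -[i|j]; rewrite cmM !monom_joinE cmM. Qed.

Lemma join1 : monom_join mone mone = mone :> {cmonom J}.
Proof. by apply/eqP/cmP => -[i|j]; rewrite monom_joinE !cm1. Qed.

Lemma eq_join m a e : (m == monom_join a e) = (resl m == a) && (resr m == e).
Proof.
apply/eqP/andP => [->|[/eqP<- /eqP<-]]; first by rewrite resl_join resr_join.
by rewrite join_res.
Qed.

Lemma join_ucml i : monom_join (ucm i) mone = ucm (inl i) :> {cmonom J}.
Proof. by apply/eqP/cmP => -[k|j]; rewrite monom_joinE ?cm1 !cmU. Qed.

Lemma join_ucmr j : monom_join mone (ucm j) = ucm (inr j) :> {cmonom J}.
Proof. by apply/eqP/cmP => -[k|l]; rewrite monom_joinE ?cm1 !cmU. Qed.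

Lemma mdeg_join a e : mdeg (monom_join a e) = (mdeg a + mdeg e)%N.
Proof.
set m := monom_join a e; rewrite !mdegE.
transitivity (\sum_(s <- map inl (finsupp a) ++ map inr (finsupp e)) m s)%N.
  apply: perm_big; apply: uniq_perm; first exact: fset_uniq.
    rewrite cat_uniq !map_inj_uniq ?fset_uniq //; try by move=> ? ? [].
    by rewrite andbT /=; apply/hasPn => s /mapP[j _ ->]; apply/mapP => -[].
  move=> s; rewrite mem_cat -cmE_neq0 monom_joinE; case: s => k.
    rewrite cmE_neq0 mem_map; last by move=> ? ? [].
    by case: mapP => [[] //|_]; rewrite orbF.
  rewrite cmE_neq0 [X in _ || X]mem_map; last by move=> ? ? [].
  by case: mapP => [[] //|_].
by rewrite big_cat !big_map /=; congr addn; apply: eq_bigr => k _;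
  rewrite monom_joinE.
Qed.

Lemma divisors_join a e : perm_eq (divisors_cm (monom_join a e))
  [seq monom_join k l | k <- divisors_cm a, l <- divisors_cm e].
Proof.
apply: uniq_perm; first exact: divisors_cm_uniq.
  apply: allpairs_uniq; rewrite ?divisors_cm_uniq // => -[k l] [k' l'] _ _ /= E.
  by rewrite -(resl_join k l) -{2}(resr_join k l) E resl_join resr_join.
move=> m; apply/mem_divisors_cmP/allpairsP => [[m' E]|[[k l] /= [+ + ->]]].
  exists (resl m, resr m) => /=; rewrite join_res; split=> //;
    apply/mem_divisors_cmP.
    by exists (resl m'); rewrite -resl_mul -E resl_join.
  by exists (resr m'); rewrite -resr_mul -E resr_join.
move=> /mem_divisors_cmP[k' ->] /mem_divisors_cmP[l' ->].
by exists (monom_join k' l'); rewrite join_mul.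
Qed.

(** The isomorphism from L[[b]][[x]] to L[[x, b]]. Orders can only grow under it, as the source
    counts the degree in x alone. *)
Definition unroll (f : fps 'I_n S) : fps J L :=
  Fps (fun m => fcoef (fcoef f (resl m)) (resr m)).

Lemma fcoef_unroll f a e : fcoef (unroll f) (monom_join a e) =
  fcoef (fcoef f a) e.
Proof. by rewrite [LHS]/= resl_join resr_join. Qed.

Lemma unrollP (f g : fps J L) :
  (forall a e, fcoef f (monom_join a e) = fcoef g (monom_join a e)) -> f = g.
Proof. by move=> h; apply: fpsP => m; rewrite -(join_res m). Qed.

Lemma unroll_is_nmod_morphism : nmod_morphism unroll.
Proof.
split=> [|f g]; apply: unrollP => a e; first by rewrite fcoef_unroll !fcoef0.
by rewrite fcoefD !fcoef_unroll.
Qed.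

Lemma unroll_is_monoid_morphism : monoid_morphism unroll.
Proof.
split=> [|f g]; apply: unrollP => a e.
  rewrite fcoef_unroll !fcoef1 -join1 eq_join resl_join resr_join.
  by case: (a == mone); rewrite ?fcoef1 ?fcoef0.
rewrite fcoef_unroll !fcoefM fcoef_sum (perm_big _ (divisors_join a e)).
rewrite big_allpairs_dep big_seq [RHS]big_seq; apply: eq_bigr => k.
move=> /mem_divisors_cmP[k' ->]; rewrite mulcmK fcoefM big_seq [RHS]big_seq.
apply: eq_bigr => l /mem_divisors_cmP[l' ->].
by rewrite join_mul !mulcmK !fcoef_unroll.
Qed.

HB.instance Definition _ := GRing.isNmodMorphism.Build (fps 'I_n S) (fps J L)
  unroll unroll_is_nmod_morphism.
HB.instance Definition _ := GRing.isMonoidMorphism.Build (fps 'I_n S) (fps J L)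
  unroll unroll_is_monoid_morphism.

Lemma unroll_const c : unroll (fps_const _ (fps_const _ c)) = fps_const _ c.
Proof.
apply: unrollP => a e; rewrite fcoef_unroll !fcoefC -join1 eq_join resl_join
  resr_join.
by case: (a == mone); rewrite ?mulr0n ?fcoef0 // fcoefC.
Qed.

Lemma unroll_X i : unroll (fX S i) = fX L (inl i).
Proof.
apply: unrollP => a e; rewrite fcoef_unroll !fvarE !fcoef_mon -join_ucml
  eq_join.
by rewrite resl_join resr_join; case: (a == _); rewrite ?fcoef0 ?fcoef1.
Qed.

Lemma unroll_constX j : unroll (fps_const _ (fX L j)) = fX L (inr j).
Proof.
apply: unrollP => a e; rewrite fcoef_unroll fcoefC !fvarE fcoef_mon -join_ucmr
  eq_join.
by rewrite resl_join resr_join; case: (a == _); rewrite ?fcoef0 ?fcoef_mon.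
Qed.

Lemma ford_unrollP N f : ford N (unroll f) <->
  forall a e, (mdeg a + mdeg e < N)%N -> fcoef (fcoef f a) e = 0.
Proof.
split=> [h a e aeN|h m]; first by rewrite -fcoef_unroll h // mdeg_join.
by rewrite -(join_res m) mdeg_join fcoef_unroll; apply: h.
Qed.

Lemma ford_unroll N f : ford N f -> ford N (unroll f).
Proof.
move=> h; apply/ford_unrollP => a e aeN.
by rewrite h ?fcoef0 // (leq_ltn_trans _ aeN) ?leq_addr.
Qed.

Lemma unroll_surj (f : fps J L) : exists g, unroll g = f.
Proof.
exists (Fps (fun a => Fps (fun e => fcoef f (monom_join a e)))).
by apply: unrollP => a e; rewrite fcoef_unroll.
Qed.

Lemma bcoef_unroll f e : bcoef (unroll f) e =
  fps_map (fun s : S => fcoef s e) f.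
Proof. by apply: fpsP => a; rewrite [LHS]/= resl_join resr_join. Qed.

(** The specialisation b = 0, which turns the factorial functions into the ordinary ones. *)
Definition bzero (f : fps J L) : fps 'I_n L := bcoef f mone.

Lemma bzero_unroll f : bzero (unroll f) = fps_map (@fcst nat L) f.
Proof. exact: bcoef_unroll. Qed.

Lemma bzero_is_nmod_morphism : nmod_morphism bzero.
Proof. by split=> [|f g]; apply: fpsP => a //; rewrite fcoef0;
  apply: fcoef0. Qed.

Lemma bzero_is_monoid_morphism : monoid_morphism bzero.
Proof.
split=> [|f g].
  by rewrite -[1](rmorph1 unroll) bzero_unroll rmorph1.
have [f' <-] := unroll_surj f; have [g' <-] := unroll_surj g.
by rewrite -rmorphM !bzero_unroll rmorphM.
Qed.

HB.instance Definition _ := GRing.isNmodMorphism.Build (fps J L) (fps 'I_n L)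
  bzero bzero_is_nmod_morphism.
HB.instance Definition _ := GRing.isMonoidMorphism.Build (fps J L) (fps 'I_n L)
  bzero bzero_is_monoid_morphism.

Lemma bzero_const c : bzero (fps_const _ c) = fps_const _ c.
Proof. by rewrite -unroll_const bzero_unroll fps_map_const /= fcst_const. Qed.

Lemma bzero_X i : bzero (fX L (inl i)) = fX L i.
Proof. by rewrite -unroll_X bzero_unroll fps_map_X. Qed.

Lemma bzero_b j : bzero (fX L (inr j)) = 0.
Proof. by rewrite -unroll_constX bzero_unroll fps_map_const /= fcst_var
  rmorph0. Qed.

Lemma ford_bzero N f : ford N f -> ford N (bzero f).
Proof. by move=> h a aN; apply: h; rewrite mdeg_join mdeg1 addn0. Qed.

End Unroll.

(** * Naturality of the defining fractions *)

Section Naturality.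
Variables (L : comNzRingType) (F : fps 'I_2 L) (chi : fps 'I_1 L).
Variables (J J' : choiceType) (psi : {rmorphism fps J L -> fps J' L}).
Hypothesis psi_const : forall c, psi (fps_const _ c) = fps_const _ c.
Hypothesis psi_ord : forall N f, ford N f -> ford N (psi f).

Lemma morph_fgl_add f g : fcst f = 0 -> fcst g = 0 ->
  psi (fgl_add F f g) = fgl_add F (psi f) (psi g).
Proof.
move=> f0 g0; rewrite /fgl_add -[F in LHS]fps_map_id.
rewrite (morph_subst (i1 := id) psi_const psi_ord) ?fps_map_id => [|i].
  by congr fps_subst; apply: funext => i; case: eqP.
by apply/ford1P; case: eqP.
Qed.

Lemma morph_fgl_opp f : fcst f = 0 -> psi (fgl_opp chi f) = fgl_opp chi (psi f).
Proof.
move=> f0; rewrite /fgl_opp -[chi in LHS]fps_map_id.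
by rewrite (morph_subst (i1 := id) psi_const psi_ord) ?fps_map_id => [|i];
  [|apply/ford1P].
Qed.

Variables (n : nat) (lam : seq nat) (b : nat -> fps J L) (x : 'I_n -> fps J L).
Hypotheses (chi0 : fcst chi = 0) (b0 : forall j, fcst (b j) =
  0) (x0 : forall i, fcst (x i) = 0).

Lemma morph_pairs r : psi (\prod_(i < n | (i < r)%N) \prod_(j < n | (i < j)%N)
    fgl_add F (x i) (x j)) =
  \prod_(i < n | (i < r)%N) \prod_(j < n | (i < j)%N)
    fgl_add F (psi (x i)) (psi (x j)).
Proof.
rewrite rmorph_prod; apply: eq_bigr => i _; rewrite rmorph_prod.
by apply: eq_bigr => j _; apply: morph_fgl_add.
Qed.

Lemma morph_bpow i k :
  psi (bpow F b (x i) k) = bpow F (fun j => psi (b j)) (psi (x i)) k.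
Proof. by rewrite rmorph_prod; apply: eq_bigr => j _; apply: morph_fgl_add. Qed.

Lemma morph_P_num : psi (P_num F lam b x) =
  P_num F lam (fun j => psi (b j)) (fun i => psi (x i)).
Proof.
rewrite /P_num rmorphM /= morph_pairs; congr (_ * _).
by rewrite rmorph_prod; apply: eq_bigr => i _; apply: morph_bpow.
Qed.

Lemma morph_Q_num : psi (Q_num F lam b x) =
  Q_num F lam (fun j => psi (b j)) (fun i => psi (x i)).
Proof.
rewrite /Q_num rmorphM /= morph_pairs; congr (_ * _).
rewrite rmorph_prod; apply: eq_bigr => i _; rewrite /bbpow.
case: (nth _ _ _) => [|k]; first by rewrite rmorph1.
by rewrite rmorphM /= morph_fgl_add // morph_bpow.
Qed.

Lemma morph_PQ_den : psi (PQ_den F chi lam x) =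
  PQ_den F chi lam (fun i => psi (x i)).
Proof.
rewrite rmorph_prod; apply: eq_bigr => i _; rewrite rmorph_prod.
apply: eq_bigr => j _; rewrite /= morph_fgl_add ?morph_fgl_opp //.
by rewrite fgl_oppE // /fneg fcst_sb.
Qed.
End Naturality.

(** * Passing to the coefficients of the monomials in b *)

Section Coefficients.
Variables (L : comNzRingType) (e : {cmonom nat}).
Local Notation S := (fps nat L).
Local Notation coef_e := (fun s : S => fcoef s e).
Local Notation cst := (@fps_const nat L).

(** Taking the coefficient of b^e is L-linear but not multiplicative; it passes through because the
    substituted series have coefficients in L. *)
Lemma coef_subst n (I : choiceType) (p : fps 'I_n S) (g : 'I_n -> fps I L) :
  fps_map coef_e (fps_subst p (fun i => fps_map cst (g i))) =
  fps_subst (fps_map coef_e p) g.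
Proof.
apply: fpsP => m; rewrite [LHS]/= fcoef_sum; apply: eq_bigr => a _.
have -> : \prod_(i < n) fps_map cst (g i) ^+ a i =
  fps_map cst (\prod_(i < n) g i ^+ a i).
  by rewrite rmorph_prod; apply: eq_bigr => i _; rewrite rmorphXn.
by rewrite fcoef_map mulrC fcoef_constM mulrC.
Qed.

Lemma coef_mapM (I : choiceType) (f : fps I L) (g : fps I S) :
  fps_map coef_e (fps_map cst f * g) = f * fps_map coef_e g.
Proof.
apply: fpsP => m; rewrite fcoefM;
  transitivity (fcoef (fcoef (fps_map cst f * g) m) e).
  by [].
rewrite fcoefM fcoef_sum; apply: eq_bigr => k _.
by rewrite fcoef_map fcoef_constM.
Qed.

Lemma coef_mapB (I : choiceType) (f g : fps I S) :
  fps_map coef_e (f - g) = fps_map coef_e f - fps_map coef_e g.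
Proof. exact: fpsP. Qed.

Variables (F : fps 'I_2 L) (chi : fps 'I_1 L) (n : nat).
Hypothesis hF : fgl_axioms F chi.
Let hS := fgl_axioms_map (@fps_const nat L) hF.

Lemma map_fneg (I : choiceType) (f : fps I L) : fcst f = 0 ->
  fps_map cst (fneg chi f) = fneg (fps_map cst chi) (fps_map cst f).
Proof. by move=> f0; rewrite [LHS]map_sb. Qed.

Lemma map_eval2 (I : choiceType) (f g : fps I L) : fcst f = 0 -> fcst g = 0 ->
  fps_map cst (eval2 F f g) = eval2 (fps_map cst F) (fps_map cst f)
    (fps_map cst g).
Proof.
move=> f0 g0; rewrite [LHS]map_sb => [|i]; last exact: fcst_pair_fun.
by apply: eq_sb => i; rewrite /pair_fun; case: eqP.
Qed.

Lemma Gamma_coef (p : fps 'I_n S) : fps_symmetric p ->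
  fgl_cancels (fps_map cst chi) p ->
  Gamma chi (fps_map coef_e p).
Proof.
move=> hs hc; split=> [w|t at_ n1].
  rewrite -coef_subst -[in RHS](hs w); congr fps_map.
  rewrite -sbE => [|i]; last exact: fcst_var.
  by congr fps_subst; apply: funext => i; rewrite fXE fps_map_X.
rewrite /at_ /t -!coef_subst; congr fps_map.
pose k := Ordinal (ltnW n1); pose l := Ordinal n1.
(* In [hc] the variable x_0 itself plays the part of t; h renames it to the separate variable
   [None]. *)
pose h (i : 'I_n) := if val i == 0%N then fX S None else fX S (Some i).
have h0 i : fcst (h i) = 0 by rewrite /h; case: eqP => _; apply: fcst_var.
have := congr1 (sb h) (hc k l isT); rewrite !sb_sb => E.
rewrite !sbE => [| i | i]; last 2 first.
- by rewrite fcst_map; (case: ifP => _; [|case: ifP => _]);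
  rewrite ?fXE ?fcst_var ?fcst0 rmorph0.
- rewrite fcst_map !fXE fgl_oppE ?fcst_var //.
  by (case: ifP => _; [|case: ifP => _]);
    rewrite ?fcst_var ?(fcst_fneg hF) rmorph0.
transitivity (sb (fun i => sb h (if i == l then fneg (fps_map cst chi)
  (fX S k) else fX S i)) p).
  apply: eq_sb => i; rewrite !fXE fgl_oppE ?fcst_var // -(inj_eq val_inj) /=.
  case: i => [[|[|i]] hi] /=; rewrite ?sb_fneg ?sb_var ?fcst_var // /h /=;
    by rewrite ?map_fneg ?fcst_var ?fps_map_X.
rewrite E; apply: eq_sb => i; rewrite !fXE -!(inj_eq val_inj) /=.
by case: i => [[|[|i]] hi] /=; rewrite ?rmorph0 // sb_var // /h /= fps_map_X.
Qed.

Lemma Gamma_plus_coef (p : fps 'I_n S) : (0 < n)%N -> fps_symmetric p ->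
  fgl_cancels (fps_map cst chi) p -> fgl_plus (fps_map cst F) p ->
  Gamma_plus F chi (fps_map coef_e p).
Proof.
move=> n0 hs hc [G hG _]; split=> [|t at_]; first exact: Gamma_coef.
pose k := Ordinal n0.
pose h (i : 'I_n) := if val i == 0%N then fX S None else fX S (Some i).
have h0 i : fcst (h i) = 0 by rewrite /h; case: eqP => _; apply: fcst_var.
exists (fps_map coef_e (sb h (G k))).
have := congr1 (sb h) (hG k); rewrite rmorphB rmorphM /= sb_sb sb_eval2 !sb_var
  // => E.
rewrite /t fXE fgl_addE ?fcst_var // -coef_mapM map_eval2 ?fcst_var //
  fps_map_X.
have -> : fX S None = h k by [].
rewrite -E coef_mapB /at_ -!coef_subst; congr (_ - _); congr fps_map.
  rewrite /t sbE => [|i]; last first.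
    by rewrite fcst_map !fXE; case: eqP => _; rewrite fcst_var rmorph0.
  by apply: eq_sb => i; rewrite !fXE /h; case: eqP => _; rewrite fps_map_X.
rewrite sbE => [|i]; last first.
  by rewrite fcst_map !fXE; case: eqP => _; rewrite ?fcst_var ?fcst0 rmorph0.
apply: eq_sb => i; rewrite fXE /upd -(inj_eq val_inj) /=.
by case: eqP => i0; rewrite ?rmorph0 // sb_var // /h; case: eqP => // _;
  rewrite fps_map_X.
Qed.

End Coefficients.

(** * The factorial powers as weights over L[[b]] *)

Section Weights.
Variables (L : comNzRingType) (F : fps 'I_2 L) (chi : fps 'I_1 L).
Hypothesis hF : fgl_axioms F chi.
Local Notation S := (fps nat L).
Local Notation cst := (@fps_const nat L).
Local Notation FS := (fps_map cst F).
Local Notation chiS := (fps_map cst chi).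

(** After [unroll] the order counts t and the b_j together, and renaming t to x_i preserves it. *)
Lemma ford_unroll_eval1 n (i : 'I_n) (h : fps 'I_1 S) N :
  ford N (unroll h) -> ford N (unroll (eval1 h (fX S i))).
Proof.
move=> /ford_unrollP hh; apply/ford_unrollP => a e ae.
rewrite /eval1 -sbE => [|_]; last exact: fcst_var.
have G b : gpow (fun _ : 'I_1 => fX S i) b = fmon (pushm (fun=> i) b).
  exact: gpow_rename.
rewrite (fps_substE (s := monoms 1 (mdeg a).+1)) ?monoms_uniq //.
- rewrite fcoef_sum big1 // => b _; rewrite G fcoef_mon.
  case: eqP => [ab|_]; last by rewrite mulr0 fcoef0.
  by rewrite mulr1 hh // -(mdeg_pushm (fun=> i)) -ab.
- by move=> j; apply: ford_var.
- move=> b; rewrite G fcoef_mon; case: (a =P _) => [->|_].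
    by move=> _; rewrite mem_monoms // mdeg_pushm.
  by rewrite mulr0 eqxx.
Qed.

(* t +_F b_j as a power series in t over L[[b]]. *)
Lemma weight_exists j : exists w : fps 'I_1 S, forall n (i : 'I_n),
  unroll (eval1 w (fX S i)) = fgl_add F (fX L (inl i)) (fX L (inr j)).
Proof.
pose A n := fps ('I_n + nat)%type L.
pose B n (i : 'I_n) (c : 'I_2) : A n :=
  if val c == 0%N then fX L (inl i) else fX L (inr j).
have B0 n (i : 'I_n) c : ford 1 (B n i c) by rewrite /B; case: ifP => _;
  apply: ford_var.
(* In S[[t]] the parameter b_j is a nonzero constant and cannot be substituted into F; the series t
   +_F b_j is formed in L[[t, b]] and read back. *)
have [w hw] := unroll_surj (fps_subst F (B 1%N ord0)).
exists w => n i; apply: fordP => N.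
(* Truncating F leaves a polynomial, which can be evaluated at a nonzero constant term and so makes
   sense on both sides of [unroll]. *)
pose T k (c : 'I_k) : fps 'I_k S := \sum_(a <- monoms 2 N)
  fps_const _ (cst (fcoef F a)) *
  (fX S c ^+ a ord0 * fps_const _ (fX L j) ^+ a (lift ord0 ord0)).
have UT k (c : 'I_k) : unroll (T k c) = fps_subst (ftrunc N F) (B k c).
  rewrite fps_subst_ftrunc // rmorph_sum; apply: eq_bigr => a _.
  rewrite !rmorphM !rmorphXn /= unroll_const unroll_X unroll_constX.
  by rewrite /gpow !big_ord_recl big_ord0 mulr1.
have wT : eval1 (T 1%N ord0) (fX S i) = T n i.
  rewrite /eval1 rmorph_sum; apply: eq_bigr => a _.
  by rewrite !rmorphM !rmorphXn /= !sb_const sb_var // fcst_var.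
have -> : unroll (eval1 w (fX S i)) - fgl_add F (fX L (inl i)) (fX L (inr j)) =
    unroll (eval1 (w - T 1%N ord0) (fX S i))
    - (fps_subst F (B n i) - fps_subst (ftrunc N F) (B n i)).
  rewrite -UT -wT /eval1 !rmorphB /= opprB addrA subrK; congr (_ - _).
apply: fordB; last exact: ford_subst_ftrunc.
apply: ford_unroll_eval1; rewrite rmorphB /= hw UT; exact: ford_subst_ftrunc.
Qed.

Lemma unroll_eval2 n (f g : fps 'I_n S) : fcst f = 0 -> fcst g = 0 ->
  unroll (eval2 FS f g) = fgl_add F (unroll f) (unroll g).
Proof.
move=> f0 g0; have p0 i : fcst (pair_fun f g i) = 0 by apply: fcst_pair_fun.
rewrite /eval2 -sbE // (morph_subst (i0 := cst) (i1 := id) (@unroll_const L n)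
  (@ford_unroll L n)) => [|i]; last exact/ford1P/p0.
by rewrite fps_map_id; congr fps_subst; apply: funext => i;
  rewrite /pair_fun; case: ifP.
Qed.

Lemma unroll_fneg n (f : fps 'I_n S) : fcst f = 0 ->
  unroll (fneg chiS f) = fgl_opp chi (unroll f).
Proof.
move=> f0; rewrite /fneg -sbE // (morph_subst (i0 := cst) (i1 :=
  id) (@unroll_const L n)
  (@ford_unroll L n)) => [|i]; last exact/ford1P/f0.
by rewrite fps_map_id.
Qed.

Lemma unroll_schur_den n (w : 'S_n) lam :
  unroll (schur_den FS chiS (size lam) (fun i => fX S (w i))) =
  PQ_den F chi lam (fun i => fX L (inl (w i))).
Proof.
have hS := fgl_axioms_map (@fps_const nat L) hF.
rewrite rmorph_prod; apply: eq_bigr => i _; rewrite rmorph_prod.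
apply: eq_bigr => j _; rewrite /= unroll_eval2 ?unroll_fneg ?unroll_X ?fcst_var
  //.
exact: (fcst_fneg hS).
Qed.

Lemma unroll_schur_num n (w : 'S_n) (lam : seq nat) (W : nat -> fps 'I_1 S)
    (V : fps ('I_n + nat)%type L -> nat -> fps ('I_n + nat)%type L) :
  (forall i k, unroll (eval1 (W k) (fX S i)) = V (fX L (inl i)) k) ->
  unroll (schur_num FS (map W lam) (fun i => fX S (w i))) =
  (\prod_(i < n | (i < size lam)%N) V (fX L (inl (w i))) (nth 0%N lam i)) *
  \prod_(i < n | (i < size lam)%N) \prod_(j < n | (i < j)%N)
    fgl_add F (fX L (inl (w i))) (fX L (inl (w j))).
Proof.
move=> hW; rewrite rmorphM /eval1_prod /pair_prod size_map !rmorph_prod;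
  congr (_ * _).
  by apply: eq_bigr => i ir; rewrite (nth_map 0%N) //= hW.
apply: eq_bigr => i _; rewrite rmorph_prod; apply: eq_bigr => j _.
by rewrite /= unroll_eval2 ?fcst_var // !unroll_X.
Qed.

Lemma weights_exist : exists WP WQ : nat -> fps 'I_1 S,
  [/\ forall n (i : 'I_n) k,
        unroll (eval1 (WP k) (fX S i)) =
          bpow F (fun j => fX L (inr j)) (fX L (inl i)) k,
      forall n (i : 'I_n) k,
        unroll (eval1 (WQ k) (fX S i)) =
          bbpow F (fun j => fX L (inr j)) (fX L (inl i)) k &
      forall k, (0 < k)%N -> exists g,
        WQ k = eval2 FS (fX S (ord0 : 'I_1)) (fX S (ord0 : 'I_1)) * g].
Proof.
have [phi hphi] := choice weight_exists.
pose WP k := \prod_(j < k) phi j.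
(* The value 1 at k = 0 has no factor t +_F t, whence the restriction to positive k below. *)
pose WQ k := if k is k'.+1
  then eval2 FS (fX S (ord0 : 'I_1)) (fX S (ord0 : 'I_1)) * WP k' else 1.
have hP n (i : 'I_n) k :
    unroll (eval1 (WP k) (fX S i)) =
      bpow F (fun j => fX L (inr j)) (fX L (inl i)) k.
  rewrite /eval1 !rmorph_prod; apply: eq_bigr => j _; exact: hphi.
exists WP, WQ; split=> // [n i [|k]|[|k] // _]; last by exists (WP k).
  by rewrite /eval1 !rmorph1.
rewrite /eval1 !rmorphM /= -hP sb_eval2 sb_var ?fcst_var //.
by rewrite unroll_eval2 ?fcst_var // unroll_X.
Qed.

End Weights.

Theorem proposition4p4 (L : comNzRingType) (F : fps 'I_2 L) (chi : fps 'I_1 L)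
    (hF : is_lazard F) (hchi : is_fgl_inverse F chi)
    (n : nat) (hn : (1 <= n)%N)
    (lam : seq nat) (hlam : strict_partition lam) (hr : (size lam <= n)%N) :
  [/\ exists p : fps 'I_n L,
        is_schurP F chi lam (fun i => 'x_i) (fun=> 0) p /\ Gamma chi p
    & exists q : fps 'I_n L,
        [/\ is_schurQ F chi lam (fun i => 'x_i) (fun=> 0) q,
            Gamma chi q & Gamma_plus F chi q]]
  /\
  [/\ exists p : fps ('I_n + nat)%type L,
        is_schurP F chi lam (fun i => 'x_(inl i)) (fun j => 'x_(inr j)) p /\
        Gamma_b chi p
    & exists q : fps ('I_n + nat)%type L,
        is_schurQ F chi lam (fun i => 'x_(inl i)) (fun j => 'x_(inr j)) q /\
        Gamma_plus_b F chi q].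
Proof.
have hA : fgl_axioms F chi by case: hF => hF1 _; apply: is_fgl_axioms.
have hS := fgl_axioms_map (@fps_const nat L) hA.
have [WP [WQ [hP hQ hQ2]]] := weights_exist F.
have chi0 : fcst chi = 0 by case: hA.
have szP : (size (map WP lam) <= n)%N by rewrite size_map.
have szQ : (size (map WQ lam) <= n)%N by rewrite size_map.
have [p [p1 p2 p3 _]] := schur_sum_exists hS szP.
have [q [q1 q2 q3 q4]] := schur_sum_exists hS szQ.
(* Parts of a strict partition are positive, so every weight that occurs has the factor t +_F t. *)
have {}q4 : fgl_plus (fps_map (@fps_const nat L) F) q.
  apply: q4 => g /mapP[k kin ->]; apply: hQ2.
  by case/andP: hlam => _ /allP; apply.
have xE : (fun i : 'I_n => 'x_i) = fX L :> ('I_n -> fps 'I_n L).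
  by apply: funext => i; rewrite fXE.
have xlE : (fun i : 'I_n => 'x_(inl i)) =
    (fun i => fX L (inl i)) :> ('I_n -> fps ('I_n + nat)%type L).
  by apply: funext => i; rewrite fXE.
have xrE : (fun j : nat => 'x_(inr j)) =
    (fun j => fX L (inr j)) :> (nat -> fps ('I_n + nat)%type L).
  by apply: funext => i; rewrite fXE.
rewrite xE xlE xrE.
have sP : is_schurP F chi lam (fun i : 'I_n => fX L (inl i)) (fun j =>
  fX L (inr j))
    (unroll p).
  move: (sof_morph (@unroll L n) p1); rewrite size_map; apply: eq_sof => w.
    by rewrite /= (unroll_schur_num F w lam (hP n)).
  by rewrite /= (unroll_schur_den hA).
have sQ : is_schurQ F chi lam (fun i : 'I_n => fX L (inl i)) (fun j =>
  fX L (inr j))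
    (unroll q).
  move: (sof_morph (@unroll L n) q1); rewrite size_map; apply: eq_sof => w.
    by rewrite /= (unroll_schur_num F w lam (hQ n)).
  by rewrite /= (unroll_schur_den hA).
have bz : (fun j : nat => bzero (fX L (inr j))) = (fun=> 0) :> (nat ->
  fps 'I_n L).
  by apply: funext => j; rewrite bzero_b.
have xz (w : 'S_n) : (fun i => bzero (fX L (inl (w i)))) =
  (fun i => fX L (w i)).
  by apply: funext => i; rewrite bzero_X.
(* The ordinary functions are the images of the factorial ones under b = 0; their membership is the
   coefficient statement for the trivial monomial in b. *)
split; split.
- exists (bzero (unroll p)); split; last first.
    by rewrite /bzero bcoef_unroll; apply: (Gamma_coef _ hA).
  apply: eq_sof (sof_morph (@bzero L n) sP) => w.
    rewrite /= (morph_P_num F (@bzero_const L n) (@ford_bzero L n)) => [|j|i];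
      by rewrite ?fcst_var // bz xz.
  rewrite /= (morph_PQ_den F (@bzero_const L n) (@ford_bzero L n)) // => [|i];
    by rewrite ?fcst_var // xz.
- exists (bzero (unroll q)); split; last 2 first.
  + by rewrite /bzero bcoef_unroll; apply: (Gamma_coef _ hA).
  + by rewrite /bzero bcoef_unroll; apply: (Gamma_plus_coef _ hA).
  apply: eq_sof (sof_morph (@bzero L n) sQ) => w.
    rewrite /= (morph_Q_num F (@bzero_const L n) (@ford_bzero L n)) => [|j|i];
      by rewrite ?fcst_var // bz xz.
  rewrite /= (morph_PQ_den F (@bzero_const L n) (@ford_bzero L n)) // => [|i];
    by rewrite ?fcst_var // xz.
- exists (unroll p); split=> // e; rewrite bcoef_unroll;
  exact: (Gamma_coef _ hA).
- exists (unroll q); split=> // e; rewrite bcoef_unroll;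
  exact: (Gamma_plus_coef _ hA).
Qed.
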